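(* Fix $k\geq 3$ and $a\in\mathbb{Z}^+$. There is a real constant $C_{k,a}>0$ such that for $n\in\mathbb{Z}^+$ and $I=\{i_1,i_2,\ldots,i_a\}\subseteq[n]$ with $i_1\geq\sqrt n$, $i_{j+1}-i_j\geq\sqrt n$ for all $j$ with $1\leq j\leq a-1$, and $n-i_a\geq\sqrt n$, we have \[d_k(I,n)=C_{k,a}f_k(n)\left(1+O_{k,a}\left(n^{-1/6}\right)\right).\]
   Context: $[n]=\{1,\dots,n\}$. For $w\in S_n$, $D_k(w)$ is the set of indices $i$ with $1\le i\le n-k+1$ and $w(i)>w(i+1)>\cdots>w(i+k-1)$. $d_k(I,n)$ is the number of $w\in S_n$ with $D_k(w)=I$, and $f_k(n)=d_k(\emptyset,n)$. $O_{k,a}(g(n))$ denotes a quantity bounded in absolute value by $Kg(n)$ for all sufficiently large $n$, where $K$ (and the threshold) depends only on $k$ and $a$; in particular the bound is uniform over all admissible $I$. *)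

(* Defs.v *)
From HB Require Import structures.
From mathcomp Require Import all_boot all_order all_algebra all_fingroup.
From mathcomp Require Import all_classical all_reals all_analysis.

Set Implicit Arguments.
Unset Strict Implicit.
Unset Printing Implicit Defensive.

Import Order.TTheory GRing.Theory Num.Theory.

(* Positions and values in [n] = {1, ..., n} are encoded by 'I_n with a shift:
   the ordinal of value m stands for the integer m + 1. *)

(* D_k(w).  For the 1-based index i + 1, the condition i + 1 <= n - k + 1 reads
   i + k <= n, and the window consists of the ordinals i, ..., i + k - 1. *)
Definition Dset (k n : nat) (w : 'S_n) : {set 'I_n} :=
  [set i : 'I_n | (i + k <= n)%N &&
    [forall p : 'I_n, forall q : 'I_n,
      [&& (i <= p)%N, q == p.+1 :> nat & (q < i + k)%N] ==> (w q < w p)%N]].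

Definition dcount (k n : nat) (I : {set 'I_n}) : nat :=
  #|[set w : 'S_n | Dset k w == I]|.

Definition fcount (k n : nat) : nat := dcount k (@finset.set0 'I_n).

Local Open Scope ring_scope.

(* The 1-based integer encoded by an ordinal, as a real number. *)
Definition pos (R : realType) (n : nat) (x : 'I_n) : R := (x.+1)%:R.

(* i_1, ..., i_a is the family i indexed from 0.  For n > 0 the gap condition
   makes i strictly increasing, so that its image has exactly a elements. *)
Definition sqrt_spaced (R : realType) (n a : nat) (i : 'I_a -> 'I_n) : Prop :=
  [/\ forall j : 'I_a, j = 0%N :> nat -> Num.sqrt (n%:R : R) <= pos R (i j),
      forall j j' : 'I_a, j' = j.+1 :> nat ->
        Num.sqrt (n%:R : R) <= pos R (i j') - pos R (i j)
    & forall j : 'I_a, j.+1 = a ->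
        Num.sqrt (n%:R : R) <= n%:R - pos R (i j)].

(* Main.v *)
Require Import Defs.
From HB Require Import structures.
From mathcomp Require Import all_boot all_order all_algebra all_fingroup.
From mathcomp Require Import all_classical all_reals all_analysis.
From mathcomp Require Import ring lra zify.

(** Encode a permutation w by its descent word, the binary word with a one at
    position p when w(p) > w(p+1).  With d = k - 1, an index lies in D_k(w)
    exactly when d consecutive ones of the descent word start there.  About the
    probability word_prob v that a uniform permutation has descent word v, two
    facts suffice: if the comparison between two adjacent letters is left
    unconstrained, the patterns on its left and on its right are independent
    (word_prob_split); and a word of r ones has probability 1 / (r+1)!
    (word_prob_nseq).

    If D_k(w) = I and the points of I are far apart, the descent word is
    v_0 0 1^d 0 v_1 0 1^d 0 ... v_a, where the gaps v_j are arbitrary words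
    without d consecutive ones (windows_at_cons, gap_sumE).  To see how the
    gaps interact with the prescribed runs, expand a boundary letter 0 as
    (no constraint) minus (letter 1).  In the second term the letter 1 joins the
    prescribed run to the adjacent run of ones of the gap; sorting by the length
    of that run gives a linear recursion which lowers the size of the gap and
    lengthens the prescribed run (run_prefix_rec).  It is solved by an
    alternating sum over the exponents congruent to 0 or 1 modulo k
    (run_inversion), in which long runs are damped by factorials.

    Applied to u_m = f_k(m) / m! itself, the inversion says that the generating
    function of u is 1 / F with F(t) the sum over j of
    t^(kj) / (kj)! - t^(kj+1) / (kj+1)!.  Let x in [1, 5/4] be a root of F and
    write F(xt) = (1 - t) G(t).  The coefficients of G are the partial sums g_m
    of the alternating series F(x) = 0, hence bounded by the first omitted term,
    and the sum of |g_m| (6/5)^m over m >= 1 is at most 1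
    (root_sum_weighted_le).  Since the increments of u_m x^m have generating
    function 1 / G, they are O((5/6)^m): thus u_m x^m converges geometrically
    to some c, and c > 0.

    Feeding this into the inversion on both sides of each prescribed run shows
    that inserting a run multiplies the normalised probability by c S x^k, where
    S > 0 is an explicit double alternating sum, up to an error geometric in the
    smallest gap (context_ok_next, gap_sum_asymptotics).  So the theorem holds
    with the constant (c S x^k)^a, and with an error O((5/6)^(sqrt n)), far
    smaller than n^(-1/6). *)

Set Implicit Arguments.
Unset Strict Implicit.
Unset Printing Implicit Defensive.

Import Order.TTheory GRing.Theory Num.Theory.
Local Open Scope ring_scope.

(** * Sums over binary words *)

(** Recursion on the length, rather than a sum over tuples, lets the words be
    cut at any position by computation. *)
Fixpoint sum_words (R : realType) (n : nat) (phi : seq bool -> R) : R :=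
  if n is n'.+1 then
    sum_words n' (fun v => phi (false :: v)) +
    sum_words n' (fun v => phi (true :: v))
  else phi [::].

Section SumWords.
Context {R : realType}.
Implicit Types (phi psi : seq bool -> R) (n p q : nat) (v w : seq bool).

Lemma eq_sum_words n phi psi :
  (forall v, size v = n -> phi v = psi v) -> sum_words n phi = sum_words n psi.
Proof.
elim: n phi psi => [|n IH] phi psi H /=; first exact: H.
by congr (_ + _); apply: IH => v sv; apply: H; rewrite /= sv.
Qed.

Lemma sum_wordsD n phi psi :
  sum_words n (fun v => phi v + psi v) = sum_words n phi + sum_words n psi.
Proof. by elim: n phi psi => [|n IH] phi psi //=; rewrite !IH addrACA. Qed.

Lemma sum_words0 n : sum_words n (fun=> 0) = 0 :> R.
Proof. by elim: n => //= n ->; rewrite addr0. Qed.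

Lemma sum_wordsZ n (c : R) phi :
  sum_words n (fun v => c * phi v) = c * sum_words n phi.
Proof. by elim: n phi => [|n IH] phi //=; rewrite !IH mulrDr. Qed.

Lemma sum_wordsZr n (c : R) phi :
  sum_words n (fun v => phi v * c) = sum_words n phi * c.
Proof.
by rewrite mulrC -sum_wordsZ; apply: eq_sum_words => v _; rewrite mulrC.
Qed.

Lemma sum_words_sum n (I : finType) (phi : I -> seq bool -> R) :
  sum_words n (fun v => \sum_i phi i v) = \sum_i sum_words n (phi i).
Proof.
by elim: n phi => [|n IH] phi //=; rewrite !IH -big_split.
Qed.

Lemma exchange_sum_words n p (phi : seq bool -> seq bool -> R) :
  sum_words n (fun v => sum_words p (phi v)) =
  sum_words p (fun w => sum_words n (phi ^~ w)).
Proof. by elim: n phi => [|n IH] phi //=; rewrite !IH -sum_wordsD. Qed.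

Lemma sum_words_cat p q phi :
  sum_words (p + q) phi =
  sum_words p (fun v => sum_words q (fun w => phi (v ++ w))).
Proof. by elim: p phi => [|p IH] phi //=; rewrite !IH. Qed.

Lemma sum_words_cons p q phi :
  sum_words (p + q.+1) phi =
  sum_words p (fun v => sum_words q (fun w => phi (v ++ false :: w))) +
  sum_words p (fun v => sum_words q (fun w => phi (v ++ true :: w))).
Proof. by rewrite sum_words_cat -sum_wordsD. Qed.

Lemma sum_words_rev n phi :
  sum_words n (fun v => phi (rev v)) = sum_words n phi.
Proof.
elim: n phi => [|n IH] phi //.
rewrite -{2}addn1 sum_words_cons /= -!(IH (fun v => phi (v ++ _))).
by congr (_ + _); apply: eq_sum_words => v _; rewrite rev_cons -cats1.
Qed.

Lemma sum_words_delta n (w : seq bool) phi :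
  size w = n -> sum_words n (fun v => (v == w)%:R * phi v) = phi w.
Proof.
elim: n w phi => [|n IH] [|b w] phi //= sw; first by rewrite mul1r.
case: sw => sw.
have H c : sum_words n (fun v => (c :: v == b :: w)%:R * phi (c :: v)) =
    (c == b)%:R * phi (c :: w).
  rewrite -(IH w (fun v => (c == b)%:R * phi (c :: v)) sw).
  apply: eq_sum_words => v _; rewrite eqseq_cons.
  by case: (c == b); rewrite ?mul1r //= !mul0r mulr0.
by rewrite !H; case: b {H} => /=; rewrite ?mul1r ?mul0r ?addr0 ?add0r.
Qed.

Lemma sum_words_ge0 n phi :
  (forall v, size v = n -> 0 <= phi v) -> 0 <= sum_words n phi.
Proof.
elim: n phi => [|n IH] phi H /=; first exact: H.
by apply: addr_ge0; apply: IH => v sv; apply: H; rewrite /= sv.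
Qed.

End SumWords.

(** * Descent words of permutations *)

Definition descent_word (m : nat) (y : 'I_m.+1 -> nat) : seq bool :=
  mkseq (fun i => (y (inord i.+1) < y (inord i))%N) m.

Lemma size_descent_word m (y : 'I_m.+1 -> nat) : size (descent_word y) = m.
Proof. exact: size_mkseq. Qed.

Lemma eq_descent_word m (y z : 'I_m.+1 -> nat) :
  y =1 z -> descent_word y = descent_word z.
Proof. by move=> yz; apply: eq_mkseq => i; rewrite !yz. Qed.

Section BlockPerm.
Context {p q : nat}.
Implicit Types (s : 'S_p) (t : 'S_q).

Definition block_fun s t (i : 'I_(p + q)) : 'I_(p + q) :=
  match fintype.split i with
  | inl a => lshift q (s a)
  | inr b => rshift p (t b)
  end.

Lemma block_fun_inj s t : injective (block_fun s t).
Proof.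
move=> i j; rewrite /block_fun -{2}(splitK i) -{2}(splitK j).
case: (fintype.split i) => a; case: (fintype.split j) => b /=.
- by move/lshift_inj/perm_inj => ->.
- by move/eqP; rewrite eq_lrshift.
- by move/eqP; rewrite eq_rlshift.
- by move/rshift_inj/perm_inj => ->.
Qed.

Definition block_perm s t : 'S_(p + q) := perm (@block_fun_inj s t).

Lemma block_perm_lshift s t a : block_perm s t (lshift q a) = lshift q (s a).
Proof. by rewrite permE /block_fun -[lshift q a]/(unsplit (inl a)) unsplitK. Qed.

Lemma block_perm_rshift s t b : block_perm s t (rshift p b) = rshift p (t b).
Proof. by rewrite permE /block_fun -[rshift p b]/(unsplit (inr b)) unsplitK. Qed.

End BlockPerm.

Section DescentWord.
Context {R : realType}.
Implicit Types (phi psi : seq bool -> R) (m p q : nat) (v w : seq bool).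

(** Only the relative order of the values of y matters: replacing each value by
    its rank turns y into a permutation, which translates the group. *)
Lemma sum_descent_word_comp m (y : 'I_m.+1 -> nat) phi : injective y ->
  \sum_(s : 'S_m.+1) phi (descent_word (fun i => y (s i))) =
  \sum_(s : 'S_m.+1) phi (descent_word (fun i => nat_of_ord (s i))).
Proof.
move=> injy.
(* The rank of j among the values of y. *)
pose rk j : nat := #|[pred l | (y l < y j)%N]|.
have rk_mono i j : (y i < y j)%N -> (rk i < rk j)%N.
  move=> lij; apply: proper_card; apply/properP; split.
    by apply/fintype.subsetP => l; rewrite !inE => /ltn_trans; apply.
  by exists i; rewrite !inE // ltnn.
have rk_lt j : (rk j < m.+1)%N.
  rewrite -[X in (_ < X)%N]card_ord; apply: proper_card; apply/properP; split.
    by apply/fintype.subsetP.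
  by exists j; rewrite // !inE ltnn.
have rk_inj : injective (fun j => Ordinal (rk_lt j)).
  move=> i j /(congr1 val) /= eij; apply: injy.
  by case: (ltngtP (y i) (y j)) => // /rk_mono; rewrite eij ltnn.
pose pi := perm rk_inj.
rewrite [RHS](reindex_inj (mulIg pi)); apply: eq_bigr => s _.
congr phi; apply: eq_mkseq => i; rewrite !permM !permE /=.
set a := s _; set b := s _.
by case: (ltngtP (y a) (y b)) => [/rk_mono| /rk_mono|/injy ->];
  rewrite ?ltnn // => /ltnW; rewrite leqNgt; case: ltnP.
Qed.

(** Averaging over the Young subgroup of permutations of positions preserving
    the two blocks: for a fixed arrangement W, permuting the positions inside a
    block makes its pattern uniform, independently of the other block. *)
Lemma sum_descent_word_split p q phi psi :
  (\sum_(W : 'S_(p + q.+1).+1)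
     phi (take p (descent_word (fun i => nat_of_ord (W i)))) *
     psi (drop p.+1 (descent_word (fun i => nat_of_ord (W i))))) *
    (p.+1`! * q.+1`!)%:R =
  (\sum_(s : 'S_p.+1) phi (descent_word (fun i => nat_of_ord (s i)))) *
  (\sum_(t : 'S_q.+1) psi (descent_word (fun i => nat_of_ord (t i)))) *
    ((p + q.+1).+1`!)%:R.
Proof.
set N := (p + q.+1).+1.
pose DL (W : 'S_N) := descent_word (fun a : 'I_p.+1 => nat_of_ord (W (lshift q.+1 a))).
pose DR (W : 'S_N) := descent_word (fun b : 'I_q.+1 => nat_of_ord (W (rshift p.+1 b))).
have takeE (W : 'S_N) : take p (descent_word (fun i => nat_of_ord (W i))) = DL W.
  apply: (@eq_from_nth _ false).
    by rewrite size_take_min !size_descent_word; lia.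
  move=> i; rewrite size_take_min size_descent_word => hi.
  have {}hi : (i < p)%N by lia.
  have hi' : (i < p + q.+1)%N by lia.
  rewrite nth_take // !nth_mkseq //.
  by congr (nat_of_ord (W _) < nat_of_ord (W _))%N; apply: val_inj;
     rewrite /= !inordK //; rewrite /N; lia.
have dropE (W : 'S_N) : drop p.+1 (descent_word (fun i => nat_of_ord (W i))) = DR W.
  apply: (@eq_from_nth _ false).
    by rewrite size_drop !size_descent_word; lia.
  move=> i; rewrite size_drop size_descent_word => hi.
  have {}hi : (i < q)%N by lia.
  have hi' : (p.+1 + i < p + q.+1)%N by lia.
  rewrite nth_drop // !nth_mkseq //.
  by congr (nat_of_ord (W _) < nat_of_ord (W _))%N; apply: val_inj;
     rewrite /= !inordK //; rewrite /N; lia.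
under eq_bigr => W _ do rewrite takeE dropE.
set A := \sum_(s : 'S_p.+1) _; set B := \sum_(t : 'S_q.+1) _.
(* Sum over the whole Young subgroup, then absorb its elements into W. *)
transitivity (\sum_(s : 'S_p.+1) \sum_(t : 'S_q.+1) \sum_(W : 'S_N)
    phi (DL W) * psi (DR W)).
  by rewrite !sumr_const /= !card_Sn -!mulrnA mulr_natr [(q.+1`! * _)%N]mulnC.
transitivity (\sum_(W : 'S_N) \sum_(s : 'S_p.+1) \sum_(t : 'S_q.+1)
    phi (DL (block_perm s t * W)%g) * psi (DR (block_perm s t * W)%g)).
  rewrite exchange_big /=.
  under [RHS]eq_bigr => W _ do rewrite exchange_big.
  rewrite [RHS]exchange_big /=; apply: eq_bigr => t _.
  rewrite [RHS]exchange_big /=; apply: eq_bigr => s _.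
  exact: (reindex_inj (mulgI (block_perm s t))).
rewrite (eq_bigr (fun=> A * B)); first by rewrite sumr_const card_Sn mulr_natr.
move=> W _; rewrite /A -(@sum_descent_word_comp p (fun a => nat_of_ord (W (lshift q.+1 a))) phi).
  rewrite /B -(@sum_descent_word_comp q (fun b => nat_of_ord (W (rshift p.+1 b))) psi).
    rewrite mulr_suml; apply: eq_bigr => s _.
    rewrite mulr_sumr; apply: eq_bigr => t _.
    rewrite /DL /DR; congr (phi _ * psi _); apply: eq_descent_word => i.
      by rewrite permM; congr (nat_of_ord (W _)); exact: (block_perm_lshift s t i).
    by rewrite permM; congr (nat_of_ord (W _)); exact: (block_perm_rshift s t i).
  by move=> a b /val_inj /perm_inj H; apply: (@rshift_inj p.+1 q.+1).
by move=> a b /val_inj /perm_inj H; apply: (@lshift_inj p.+1 q.+1).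
Qed.

Definition word_prob v : R :=
  (\sum_(s : 'S_(size v).+1)
      (descent_word (fun i => nat_of_ord (s i)) == v)%:R) / (size v).+1`!%:R.

Lemma word_prob_ge0 v : 0 <= word_prob v.
Proof. by apply: divr_ge0 => //; apply: sumr_ge0. Qed.

(** The left side forgets whether the letter between v and w is a descent. *)
Lemma word_prob_split v w :
  word_prob (v ++ false :: w) + word_prob (v ++ true :: w) =
  word_prob v * word_prob w.
Proof.
have fn0 m : m`!%:R != 0 :> R by rewrite pnatr_eq0 -lt0n fact_gt0.
rewrite /word_prob !size_cat /=.
set p := size v; set q := size w.
have := @sum_descent_word_split p q (fun x => (x == v)%:R) (fun x => (x == w)%:R).
set A := \sum_(s : 'S_p.+1) _; set B := \sum_(s : 'S_q.+1) _.
move=> H; rewrite -mulrDl -big_split /=.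
rewrite (eq_bigr (fun W : 'S_(p + q.+1).+1 =>
    ((take p (descent_word (fun i => nat_of_ord (W i))) == v)%:R *
     (drop p.+1 (descent_word (fun i => nat_of_ord (W i))) == w)%:R : R))).
  apply: (mulIf (fn0 (p + q.+1).+1)); rewrite divfK //.
  apply: (mulIf (mulf_neq0 (fn0 p.+1) (fn0 q.+1))).
  rewrite -natrM H natrM mulf_div.
  by field; rewrite !fn0.
move=> W _; set d := descent_word _.
have sd : size d = (p + q.+1)%N by rewrite size_descent_word.
have ed : d = take p d ++ nth false d p :: drop p.+1 d.
  by rewrite -drop_nth ?cat_take_drop // sd; lia.
have st : size (take p d) = size v by rewrite size_take_min sd; lia.
rewrite {1 2}ed !eqseq_cat // !eqseq_cons -natrM mulnb.
by case: (take p d == v); case: (nth _ _ _); case: (_ == w); rewrite ?addr0 ?add0r.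
Qed.

(** Exactly one permutation is decreasing: a decreasing map of 'I_r.+1 into
    itself has no room to differ from the reversal. *)
Lemma word_prob_nseq r : word_prob (nseq r true) = (r.+1`!%:R)^-1.
Proof.
rewrite /word_prob size_nseq (bigD1 (perm (@rev_ord_inj r.+1))) //=.
rewrite big1 ?addr0.
  rewrite (_ : _ == _ = true) ?mul1r //; apply/eqP.
  apply: (@eq_from_nth _ false); first by rewrite size_descent_word size_nseq.
  move=> i; rewrite size_descent_word => hi.
  by rewrite nth_mkseq // nth_nseq hi !permE /= !inordK //; lia.
move=> s; apply: contraNeq; rewrite pnatr_eq0 eqb0 negbK => /eqP hs.
have step i : (i < r)%N -> (s (inord i.+1) < s (inord i))%N.
  move=> hi; have := congr1 (nth false ^~ i) hs.
  by rewrite nth_mkseq // nth_nseq hi.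
have far j : (j <= r)%N -> forall i, (i <= j)%N -> (s (inord j) + (j - i) <= s (inord i))%N.
  elim: j => [|j IH] hj i; first by rewrite leqn0 => /eqP ->; lia.
  rewrite leq_eqVlt => /predU1P [->|hi]; first by lia.
  by have := IH (ltnW hj) i hi; have := step j hj; lia.
apply/eqP/permP => i; apply: val_inj; rewrite permE /=.
have hi := ltn_ord i.
have := far i hi 0%N isT; have := far r (leqnn r) i hi.
by rewrite inord_val; have := ltn_ord (s (inord 0)); lia.
Qed.

Lemma sum_descent_word m phi :
  \sum_(s : 'S_m.+1) phi (descent_word (fun i => nat_of_ord (s i))) =
  m.+1`!%:R * sum_words m (fun v => word_prob v * phi v).
Proof.
have fn0 : m.+1`!%:R != 0 :> R by rewrite pnatr_eq0 -lt0n fact_gt0.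
rewrite -sum_wordsZ.
transitivity (sum_words m (fun v => \sum_(s : 'S_m.+1)
    (v == descent_word (fun i => nat_of_ord (s i)))%:R * phi v)).
  rewrite sum_words_sum; apply: eq_bigr => s _.
  by rewrite sum_words_delta // size_descent_word.
apply: eq_sum_words => v sv; rewrite -mulr_suml mulrA; congr (_ * _).
rewrite /word_prob sv mulrC divfK //.
by apply: eq_bigr => s _; rewrite eq_sym.
Qed.

End DescentWord.

(** * Binary words without long runs of ones *)

(** The default false of nth makes a window that sticks out of v fail. *)
Definition window (d : nat) (v : seq bool) (p : nat) : bool :=
  all (fun t => nth false v (p + t)%N) (iota 0 d).

Definition run_free (d : nat) (v : seq bool) : bool :=
  ~~ has (window d v) (iota 0 (size v)).

Section Windows.
Context (d : nat) (d_gt0 : (0 < d)%N).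
Implicit Types (v w x : seq bool).

Lemma windowP v p :
  reflect (forall t, (t < d)%N -> nth false v (p + t)%N) (window d v p).
Proof.
by apply: (iffP allP) => H t; [move=> td; apply: H|]; rewrite mem_iota // => /H.
Qed.

Lemma window_size v p : window d v p -> (p + d <= size v)%N.
Proof.
move/windowP/(_ d.-1) => H; rewrite leqNgt; apply/negP => lt.
by move: H; rewrite nth_default; [move/(_ ltac:(lia))|lia].
Qed.

Lemma run_freeP v : reflect (forall p, ~~ window d v p) (run_free d v).
Proof.
apply: (iffP hasPn) => H p; last by move=> _; exact: H.
apply/negP => wp; have := window_size wp => lp.
by have := H p; rewrite mem_iota wp => /(_ ltac:(lia)).
Qed.

Lemma window_cat v w p : window d (v ++ w) (size v + p) = window d w p.
Proof.
apply/windowP/windowP => H t /H;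
  by rewrite nth_cat -addnA ltnNge leq_addr /= addKn.
Qed.

Lemma window_cat_nth v p q :
  nth false v q = false -> (p <= q < p + d)%N -> window d v p = false.
Proof.
move=> vq hq; apply/negP => /windowP /(_ (q - p)%N).
by rewrite subnKC; [rewrite vq => /(_ ltac:(lia))|lia].
Qed.

Lemma window_catl v w p : (p + d <= size v)%N -> window d (v ++ w) p = window d v p.
Proof.
move=> hp; apply/windowP/windowP => H t td; have := H t td;
  by rewrite nth_cat (_ : (_ < _)%N = true) //; lia.
Qed.

Lemma run_free_cons j v :
  run_free d (nseq j true ++ false :: v) = (j < d)%N && run_free d v.
Proof.
apply/run_freeP/andP => [H|[jd /run_freeP fv] p].
  split.
    rewrite ltnNge; apply/negP => dj; move/negP: (H 0%N); apply; apply/windowP => t td.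
    by rewrite nth_cat size_nseq nth_nseq add0n (leq_trans td dj).
  apply/run_freeP => p; rewrite -(window_cat (rcons (nseq j true) false)).
  by rewrite cat_rcons.
have [pj|pj] := leqP p j.
  rewrite (@window_cat_nth _ p j) //; last by lia.
  by rewrite nth_cat size_nseq ltnn subnn.
rewrite -cat_rcons (_ : p = size (rcons (nseq j true) false) + (p - j.+1))%N.
  by rewrite window_cat.
by rewrite size_rcons size_nseq; lia.
Qed.

Lemma run_free_nseq j : run_free d (nseq j true) = (j < d)%N.
Proof.
apply/run_freeP/idP => [H|jd p].
  rewrite ltnNge; apply/negP => dj; move/negP: (H 0%N); apply; apply/windowP => t td.
  by rewrite nth_nseq add0n (leq_trans td dj).
by apply/negP => /window_size; rewrite size_nseq; lia.
Qed.

Lemma run_free_nseq_cat v : run_free d (nseq d true ++ v) = false.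
Proof.
apply/negbTE/negP => /run_freeP fv; move/negP: (fv 0%N); apply; apply/windowP => t td.
by rewrite nth_cat size_nseq nth_nseq add0n td.
Qed.

Lemma window_rev v p :
  (p + d <= size v)%N -> window d (rev v) p = window d v (size v - p - d)%N.
Proof.
move=> hp; apply/windowP/windowP => H t td.
  have := H (d - t.+1)%N; rewrite nth_rev; last by lia.
  by rewrite (_ : size v - _ = size v - p - d + t)%N; [apply; lia|lia].
rewrite nth_rev; last by lia.
have := H (d - t.+1)%N.
by rewrite (_ : (size v - p - d) + _ = size v - (p + t).+1)%N; [apply; lia|lia].
Qed.

Lemma run_free_rev v : run_free d (rev v) = run_free d v.
Proof.
suff H w : run_free d w -> run_free d (rev w).
  by apply/idP/idP => /H //; rewrite revK.
move=> /run_freeP fw; apply/run_freeP => p; apply/negP => wp.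
have := window_size wp; rewrite size_rev => hp; move: wp.
by rewrite window_rev //; exact/negP.
Qed.

End Windows.

Definition free_sum (R : realType) (d n : nat) (phi : seq bool -> R) : R :=
  sum_words n (fun v => (run_free d v)%:R * phi v).

Section FreeSum.
Context {R : realType} (d : nat) (d_gt0 : (0 < d)%N).
Implicit Types (phi psi : seq bool -> R) (n m r : nat) (v w : seq bool).

Lemma eq_free_sum n phi psi :
  (forall v, size v = n -> phi v = psi v) -> free_sum d n phi = free_sum d n psi.
Proof. by move=> H; apply: eq_sum_words => v /H ->. Qed.

Lemma free_sumD n phi psi :
  free_sum d n (fun v => phi v + psi v) = free_sum d n phi + free_sum d n psi.
Proof.
by rewrite /free_sum -sum_wordsD; apply: eq_sum_words => v _; rewrite mulrDr.
Qed.

Lemma free_sumZ n c phi :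
  free_sum d n (fun v => c * phi v) = c * free_sum d n phi.
Proof.
by rewrite /free_sum -sum_wordsZ; apply: eq_sum_words => v _; rewrite mulrCA.
Qed.

Lemma free_sumZr n c phi :
  free_sum d n (fun v => phi v * c) = free_sum d n phi * c.
Proof.
by rewrite /free_sum -sum_wordsZr; apply: eq_sum_words => v _; rewrite mulrA.
Qed.

Lemma free_sum_rev n phi :
  free_sum d n (fun v => phi (rev v)) = free_sum d n phi.
Proof.
rewrite /free_sum -[RHS]sum_words_rev; apply: eq_sum_words => v _.
by rewrite run_free_rev.
Qed.

Lemma free_sum_ge0 n phi : (forall v, 0 <= phi v) -> 0 <= free_sum d n phi.
Proof. by move=> H; apply: sum_words_ge0 => v _; apply: mulr_ge0. Qed.

(** Splits a word by the length t of its initial run of ones, counted after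
    the j ones already present. *)
Lemma sum_words_run j n phi : (j < d)%N ->
  sum_words n (fun v => (run_free d (nseq j true ++ v))%:R * phi v) =
  \sum_(t < d - j) (if (t < n)%N
     then free_sum d (n - t.+1) (fun v => phi (nseq t true ++ false :: v)) else 0) +
  (n + j < d)%N%:R * phi (nseq n true).
Proof.
elim: n j phi => [|n IH] j phi jd.
  by rewrite big1 ?add0r ?cats0 ?run_free_nseq //= cats0 run_free_nseq.
rewrite /= -(subnSK jd) big_ord_recl /= subn1 /= -addrA; congr (_ + _).
  apply: eq_sum_words => v _.
  by rewrite (@run_free_cons d d_gt0 j v) jd.
rewrite (eq_sum_words (psi := fun v =>
   (run_free d (nseq j.+1 true ++ v))%:R * phi (true :: v))); last first.
  by move=> v _; rewrite -cat_rcons -[rcons _ _]cats1 -(nseqD j 1) addn1.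
have [jd'|dj] := ltnP j.+1 d.
  by rewrite IH // addnS.
have -> : d = j.+1 by lia.
rewrite subnn big_ord0 add0r (_ : (n.+1 + j < j.+1)%N = false) ?mul0r; last by lia.
rewrite -[RHS](sum_words0 n); apply: eq_sum_words => v _.
by rewrite run_free_nseq_cat // mul0r.
Qed.

(** The argument m counts letters of the permutation, one more than the bits of
    the gap.  For m = 0 there is no gap and no separating zero; this value is
    the one that makes run_prefix_rec hold for all m. *)
Definition run_prefix_sum phi m r : R :=
  if m is m'.+1 then free_sum d m' (fun v => phi (nseq r true ++ false :: v))
  else phi (nseq r true).

Lemma free_sum_run phi m r :
  free_sum d m (fun v => phi (nseq r true ++ v)) =
  \sum_(s < d) (if (s <= m)%N then run_prefix_sum phi (m - s) (r + s) else 0).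
Proof.
rewrite /free_sum.
have := @sum_words_run 0 m (fun v => phi (nseq r true ++ v)) d_gt0.
rewrite /= => ->; rewrite subn0 addn0.
transitivity (\sum_(t < d) ((if (t < m)%N then
     free_sum d (m - t.+1) (fun v => phi (nseq (r + t) true ++ false :: v)) else 0)
   + (if t == m :> nat then phi (nseq (r + t) true) else 0))); last first.
  apply: eq_bigr => t _.
  case: ltngtP => [tm|tm|->]; rewrite ?addr0 ?subnn ?add0r //.
  by rewrite -(subnSK tm).
rewrite big_split /=; congr (_ + _).
  apply: eq_bigr => t _; case: ifP => // _.
  by apply: eq_free_sum => v _; rewrite catA -nseqD.
rewrite -big_mkcond /= -nseqD.
have [md|dm] := ltnP m d; first by rewrite (big_pred1 (Ordinal md)) ?mul1r.
by rewrite mul0r big1 // => t /eqP tm; have := ltn_ord t; lia.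
Qed.

(** The term s = 0 is the gap separated from the run by a zero.  The terms
    s >= 1 are the gaps glued to the run, sorted by the number of letters that
    the first run of the gap adds to it. *)
Lemma run_prefix_rec phi m r :
  \sum_(s < d.+1) (if (s <= m)%N then run_prefix_sum phi (m - s) (r + s) else 0) =
  if m is m'.+1 then free_sum d m' (fun v =>
    phi (nseq r true ++ false :: v) + phi (nseq r true ++ true :: v))
  else phi (nseq r true).
Proof.
rewrite big_ord_recl /= subn0 addn0.
case: m => [|m]; first by rewrite big1 ?addr0.
rewrite free_sumD; congr (_ + _).
rewrite (eq_free_sum (psi := fun v => phi (nseq r.+1 true ++ v))).
  rewrite free_sum_run; apply: eq_bigr => s _.
  by rewrite /bump /= add1n ltnS subSS addSnnS.
by move=> v _; rewrite -cat_rcons -cats1 -(nseqD r 1) addn1.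
Qed.

End FreeSum.

(** * Words whose long runs are prescribed *)

Definition windows_at (d : nat) (v : seq bool) (f : nat -> bool) : bool :=
  `[< forall p, window d v p = f p >].

Lemma windows_atP d v f :
  reflect (forall p, window d v p = f p) (windows_at d v f).
Proof. exact: asboolP. Qed.

(** The total weight of all ways to fill a gap of b bits, followed by a
    prescribed run of d ones between two zeros, as a function of the remaining
    word w. *)
Definition next_context (R : realType) (d b : nat) (delta : seq bool -> R)
    (w : seq bool) : R :=
  free_sum d b (fun v => delta (v ++ false :: nseq d true ++ false :: w)).

Fixpoint gap_sum (R : realType) (d b : nat) (bs : seq nat)
    (delta : seq bool -> R) : R :=
  if bs is b' :: bs' then gap_sum d b' bs' (next_context d b delta)
  else free_sum d b delta.

Fixpoint gap_size (d b : nat) (bs : seq nat) : nat :=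
  if bs is b' :: bs' then (b + (d + (gap_size d b' bs').+1).+1)%N else b.

(** The starting positions of the prescribed runs: the first one follows b bits
    of gap and a zero, and the next gap starts d + 1 bits later. *)
Fixpoint gap_pos (d b : nat) (bs : seq nat) (p : nat) : bool :=
  if bs is b' :: bs' then
    (p == b.+1) || ((b + d).+2 <= p)%N && gap_pos d b' bs' (p - (b + d).+2)
  else false.

Section GapSum.
Context {R : realType} (d : nat) (d_gt0 : (0 < d)%N).
Implicit Types (delta : seq bool -> R) (b : nat) (bs : seq nat).

Lemma windows_at_nil v : windows_at d v xpred0 = run_free d v.
Proof.
apply/windows_atP/run_freeP => // H p; first by rewrite H.
by apply/negbTE.
Qed.

(** The window starting at b + 1 forces the ones of x; a one at c or at c'
    would create a second window overlapping it, which gap_pos excludes. *)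
Lemma windows_at_cons b b' bs v x w (c c' : bool) : size v = b -> size x = d ->
  windows_at d (v ++ c :: x ++ c' :: w) (gap_pos d b (b' :: bs)) =
  [&& ~~ c, x == nseq d true, ~~ c', run_free d v &
      windows_at d w (gap_pos d b' bs)].
Proof.
move=> sv sx.
set V := v ++ _.
have nV i : (i <= d.+1)%N -> nth false V (b + i) = nth false (c :: x ++ [:: c']) i.
  move=> hi; rewrite /V nth_cat -sv ltnNge leq_addr /= addKn.
  case: i hi => // i hi /=; rewrite !nth_cat sx; case: ltnP => // di.
  by rewrite (_ : i - d = 0)%N //; lia.
have VE : V = (v ++ c :: rcons x c') ++ w by rewrite /V -catA /= cat_rcons.
have sVE : size (v ++ c :: rcons x c') = (b + d).+2.
  by rewrite size_cat /= size_rcons sv sx; lia.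
have wV p : window d V ((b + d).+2 + p) = window d w p.
  by rewrite VE -sVE window_cat.
apply/windows_atP/and5P.
  move=> H.
  have xE : x = nseq d true.
    apply: (@eq_from_nth _ false); first by rewrite size_nseq.
    move=> i; rewrite sx => hi.
    have := H b.+1; rewrite /= eqxx /= => /windowP /(_ i hi).
    by rewrite addSnnS (nV i.+1 (leqW hi)) //= nth_cat sx hi nth_nseq hi.
  have Hf p : (p <= (b + d).+1)%N -> p != b.+1 -> window d V p = false.
    move=> hp hb; rewrite H /= (negbTE hb) /=.
    by rewrite leqNgt ltnS hp.
  split.
  - apply/negP => ct; have /negP := negbT (Hf b ltac:(lia) ltac:(lia)); apply.
    apply/windowP => t td; rewrite (nV t); last by lia.
    case: t td => [|t] td //=; rewrite nth_cat sx xE nth_nseq.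
    by rewrite (ltnW td).
  - by apply/eqP.
  - apply/negP => ct; have /negP := negbT (Hf b.+2 ltac:(lia) ltac:(lia)); apply.
    apply/windowP => t td; rewrite !addSnnS (nV t.+2); last by lia.
    rewrite /= nth_cat sx; case: ltnP => [lt|_]; first by rewrite xE nth_nseq lt.
    by rewrite (_ : t.+1 - d = 0)%N //; lia.
  - apply/(run_freeP d_gt0) => p; apply/negP => wp.
    have hp := window_size d_gt0 wp; rewrite sv in hp.
    have := Hf p ltac:(lia) ltac:(lia).
    by rewrite /V window_catl ?wp // sv.
  - apply/windows_atP => p; rewrite -wV H /=.
    by rewrite (_ : (_ == _) = false) ?leq_addr ?addKn //; lia.
case=> /negbTE c0 /eqP xE /negbTE c'0 /(run_freeP d_gt0) fv /windows_atP Hw p.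
have nb : nth false V b = false by rewrite -(addn0 b) nV //= c0.
have nbd : nth false V (b + d.+1) = false.
  by rewrite nV //= nth_cat sx ltnn subnn.
rewrite /=; have [->|pb] /= := eqVneq p b.+1.
  by apply/windowP => t td; rewrite addSnnS (nV t.+1 (leqW td)) //= nth_cat sx td xE nth_nseq td //.
have [hp|hp] := leqP (b + d).+2 p.
  by rewrite -{1}(subnKC hp) wV Hw.
have [pb1|bp] := leqP p b.
  have [pd|pd] := leqP (p + d) b.
    by rewrite /V window_catl ?sv // (negbTE (fv p)).
  by rewrite (window_cat_nth d_gt0 nb) // pb1.
by rewrite (window_cat_nth d_gt0 nbd) //; lia.
Qed.

Lemma gap_sumE b bs delta :
  gap_sum d b bs delta =
  sum_words (gap_size d b bs)
    (fun v => (windows_at d v (gap_pos d b bs))%:R * delta v).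
Proof.
elim: bs b delta => [|b' bs IH] b delta /=.
  by apply: eq_sum_words => v _; rewrite windows_at_nil.
rewrite IH sum_words_cat.
set N := gap_size d b' bs.
transitivity (sum_words N (fun w => sum_words b (fun v => (run_free d v)%:R *
   ((windows_at d w (gap_pos d b' bs))%:R *
     delta (v ++ false :: nseq d true ++ false :: w))))).
  apply: eq_sum_words => w _; rewrite -sum_wordsZ.
  by apply: eq_sum_words => v _; rewrite mulrCA.
rewrite exchange_sum_words; apply: eq_sum_words => v sv /=.
have H := @windows_at_cons b b' bs v _ _ _ _ sv.
rewrite [X in _ = _ + X](_ : _ = 0); last first.
  rewrite -[RHS](sum_words0 (d + N.+1)) sum_words_cat [RHS]sum_words_cat.
  apply: eq_sum_words => x sx.
  by apply: eq_sum_words => -[|c' w] // sw; rewrite (H _ _ true) // mul0r.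
rewrite addr0 sum_words_cat /=.
transitivity (sum_words d (fun x => (x == nseq d true)%:R * sum_words N (fun w =>
    (run_free d v)%:R * ((windows_at d w (gap_pos d b' bs))%:R *
     delta (v ++ false :: x ++ false :: w))))).
  by rewrite sum_words_delta ?size_nseq.
apply: eq_sum_words => x sx.
rewrite [X in _ = _ + X](_ : _ = 0); last first.
  rewrite -[RHS](sum_words0 N); apply: eq_sum_words => w sw.
  by rewrite H //= !andbF mul0r.
rewrite addr0 -sum_wordsZ; apply: eq_sum_words => w sw.
rewrite H //=; case: eqP => [->|_] /=; last by rewrite !mul0r.
by rewrite mul1r mulrA -natrM mulnb.
Qed.

End GapSum.

(** * Descent sets and windows *)

Lemma mem_Dset d N (w : 'S_N.+1) (i : 'I_N.+1) : (0 < d)%N ->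
  (i \in Dset d.+1 w) = window d (descent_word (fun j => nat_of_ord (w j))) i.
Proof.
move=> d_gt0; rewrite inE; apply/andP/windowP => [[iN /forallP Hw] t td|Hw].
  have tN : (i + t < N)%N by lia.
  rewrite nth_mkseq //.
  have /forallP /(_ (inord (i + t).+1)) /implyP := Hw (inord (i + t)).
  by apply; rewrite !inordK ?eqxx /=; lia.
have := window_size d_gt0 (introT (@windowP d _ i) Hw).
rewrite size_descent_word => iN; split; first by lia.
apply/forallP => p; apply/forallP => q; apply/implyP => /and3P [ip /eqP qp qi].
have := Hw (p - i)%N ltac:(lia).
rewrite subnKC // nth_mkseq; last by have := ltn_ord q; lia.
by rewrite -qp !inord_val.
Qed.

(** The descent word determines D_k(w), so the count is n! times a
    probability. *)
Lemma dcountE (R : realType) d N (I : {set 'I_N.+1}) (f : nat -> bool) :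
  (0 < d)%N -> (forall i : 'I_N.+1, (i \in I) = f i) ->
  (forall p, f p -> (p < N.+1)%N) ->
  (dcount d.+1 I)%:R =
  N.+1`!%:R * sum_words N (fun v => (windows_at d v f)%:R * word_prob v) :> R.
Proof.
move=> d_gt0 If fN; rewrite /dcount -sum1_card natr_sum big_mkcond /=.
transitivity (N.+1`!%:R * sum_words N (fun v => word_prob v * (windows_at d v f)%:R) : R);
  last by congr (_ * _); apply: eq_sum_words => v _; rewrite mulrC.
rewrite -sum_descent_word; apply: eq_bigr => w _; rewrite inE.
rewrite (_ : (_ == _) = windows_at d (descent_word (fun i => nat_of_ord (w i))) f).
  by case: windows_at.
apply/eqP/windows_atP => [DI p|H].
  have [pN|Np] := ltnP p N.+1; first by rewrite -(mem_Dset w (Ordinal pN) d_gt0) DI If.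
  rewrite (_ : f p = false); last by apply/negP => /fN; lia.
  by apply/negP => /(window_size d_gt0); rewrite size_descent_word; lia.
by apply/setP => i; rewrite mem_Dset // H If.
Qed.

(** * Well separated positions and their gaps *)

Section Gaps.
Context (d n q : nat).
Implicit Types (o p : nat) (ps : seq nat).

(** A gap of g letters has g - 1 bits. The list ps holds starting positions of
    the runs; without any, the gap extends to the end n. *)
Definition first_gap o ps : nat := (head n ps - o).-1.

Fixpoint next_gaps ps : seq nat :=
  if ps is p :: ps' then first_gap (p + d.+1) ps' :: next_gaps ps' else [::].

(** Every gap has at least q letters; o is the position of the first letter
    after the previous run. *)
Fixpoint gaps_at_least o ps : bool :=
  if ps is p :: ps' then (o + q <= p)%N && gaps_at_least (p + d.+1) ps'
  else (o + q <= n)%N.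

Lemma gaps_at_leastW o ps : gaps_at_least o ps -> (o + q <= n)%N.
Proof. by elim: ps o => [|p ps IH] o /=; [lia|case/andP => H /IH; lia]. Qed.

Lemma gap_size_gaps o ps : (0 < q)%N -> gaps_at_least o ps ->
  gap_size d (first_gap o ps) (next_gaps ps) = (n - o).-1.
Proof.
move=> q0; elim: ps o => [|p ps IH] o //= /andP[op H].
by rewrite IH // /first_gap /=; have := gaps_at_leastW H; lia.
Qed.

Lemma gap_pos_gaps o ps p : (0 < q)%N -> gaps_at_least o ps ->
  gap_pos d (first_gap o ps) (next_gaps ps) p = (p + o \in ps)%N.
Proof.
move=> q0; elim: ps o p => [|p' ps IH] o p //= /andP[op H].
rewrite in_cons /first_gap /=.
have -> : (p == (p' - o).-1.+1) = (p + o == p')%N by lia.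
congr (_ || _).
have [le|lt] /= := leqP ((p' - o).-1 + d).+2 p.
  by rewrite IH // (_ : (p - _ + (p' + d.+1)) = p + o)%N //; lia.
apply/esym/negbTE; apply: contraL lt => ppo; rewrite -leqNgt.
suff : (p' + d.+1 <= p + o)%N by lia.
clear IH; move: (p' + d.+1)%N H ppo; elim: ps => [|p1 ps IH] s //= /andP[sp H].
by rewrite in_cons => /predU1P[->|/(IH _ H)]; lia.
Qed.

Lemma gaps_large o ps : gaps_at_least o ps ->
  all (fun b => (q.-1 <= b)%N) (first_gap o ps :: next_gaps ps).
Proof.
elim: ps o => [|p ps IH] o /=; first by rewrite andbT /first_gap /=; lia.
by case/andP => op /IH /= ->; rewrite andbT /first_gap /=; lia.
Qed.

Lemma size_next_gaps ps : size (next_gaps ps) = size ps.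
Proof. by elim: ps => //= p ps ->. Qed.

Lemma gaps_at_least_nth o ps :
  (forall j, (j < size ps)%N -> ((if j is j'.+1 then nth 0 ps j' + d.+1 else o) + q <= nth 0 ps j)%N) ->
  ((if size ps is j'.+1 then nth 0 ps j' + d.+1 else o) + q <= n)%N ->
  gaps_at_least o ps.
Proof.
elim: ps o => [|p ps IH] o //= H1 H2; rewrite (H1 0%N) //=; apply: IH.
  by move=> [|j] hj; [apply: (H1 1%N)|apply: (H1 j.+2)].
by case: ps H1 H2.
Qed.

End Gaps.

(** * Limits with a geometric rate *)

Section Analysis.
Context {R : realType}.
Import numFieldNormedType.Exports.
Local Open Scope classical_set_scope.

Lemma geometric_cvg (s : nat -> R) (K th : R) : 0 <= th < 1 ->
  (forall N M, (N <= M)%N -> `|s M - s N| <= K * th ^+ N) ->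
  cvgn s.
Proof.
move=> /andP[th0 th1] H; apply/cauchy_cvgP/cauchy_exP => e e0.
have : (fun N => K * th ^+ N) @ \oo --> (0 : R).
  by apply: cvg_geometric; rewrite ger0_norm.
move=> /cvgr0Pnorm_lt /(_ e e0) [N _ HN].
exists (s N); exists N => // M /= NM.
rewrite /ball /= distrC; apply: le_lt_trans (H N M NM) _.
by apply: le_lt_trans (HN N (leqnn N)); rewrite ler_norm.
Qed.

Lemma geometric_limn (s : nat -> R) (K th : R) : 0 <= th < 1 ->
  (forall N M, (N <= M)%N -> `|s M - s N| <= K * th ^+ N) ->
  forall N, `|s N - limn s| <= K * th ^+ N.
Proof.
move=> hth H N; have cs := geometric_cvg hth H.
have c : (fun n => `|s n - s N|) @ \oo --> `|limn s - s N|.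
  by apply: cvg_norm; apply: cvgB => //; exact: cvg_cst.
rewrite distrC -(cvg_lim _ c) //; apply: limr_le; first by apply/cvg_ex; exists `|limn s - s N|.
by exists N => // M /= NM; apply: H.
Qed.

Lemma limn_eq_geometric (s : nat -> R) (K th l : R) : 0 <= th < 1 ->
  (forall N, `|s N - l| <= K * th ^+ N) -> s @ \oo --> l.
Proof.
move=> /andP[th0 th1] H; apply/cvgrPdist_lt => e e0.
have : (fun N => K * th ^+ N) @ \oo --> (0 : R).
  by apply: cvg_geometric; rewrite ger0_norm.
move=> /cvgr0Pnorm_lt /(_ e e0) [N _ HN].
exists N => // M /= NM; rewrite distrC; apply: le_lt_trans (H M) _.
by apply: le_lt_trans (HN M NM); rewrite ler_norm.
Qed.

Lemma geometric_small (K th e : R) : 0 <= th < 1 -> 0 < e ->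
  exists N, forall M, (N <= M)%N -> K * th ^+ M < e.
Proof.
move=> /andP[th0 th1] e0.
have : (fun N => K * th ^+ N) @ \oo --> (0 : R).
  by apply: cvg_geometric; rewrite ger0_norm.
move=> /cvgr0Pnorm_lt /(_ e e0) [N _ HN]; exists N => M NM.
by apply: le_lt_trans (HN M NM); rewrite ler_norm.
Qed.

Lemma exp_partial_sum_le (z : R) N : 0 <= z ->
  \sum_(e < N) z ^+ e / e`!%:R <= expR z.
Proof.
move=> z0; have := @nondecreasing_cvgn_le R (series (exp_coeff z)) _
  (is_cvg_series_exp_coeff z) N.
rewrite /series /= big_mkord; apply.
by apply/nondecreasing_seqP => n; rewrite big_nat_recr //= lerDl exp_coeff_ge0.
Qed.

Lemma pseries_inv_fact_cvg (c : nat -> R) (x : R) :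
  (forall i, `|c i| <= i`!%:R^-1) -> cvgn (pseries c x).
Proof.
move=> hc; apply: normed_cvg.
apply: (@series_le_cvg _ _ (exp_coeff `|x|)) => [n|n|n|].
- exact: normr_ge0.
- exact: exp_coeff_ge0.
- by rewrite exp_coeffE /= normrM normrX ler_wpM2r ?exprn_ge0.
- exact: is_cvg_series_exp_coeff.
Qed.

Lemma pseries_diffs_inv_fact_le (c : nat -> R) :
  (forall i, `|c i| <= i`!%:R^-1) ->
  forall i, `|pseries_diffs c i| <= i`!%:R^-1.
Proof.
move=> hc i; rewrite /pseries_diffs normrM normr_nat.
apply: le_trans (ler_wpM2l (ler0n _ _) (hc i.+1)) _.
by rewrite factS natrM invfM mulrA divff ?mul1r // pnatr_eq0.
Qed.

Lemma pseries_inv_fact_continuous (c : nat -> R) :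
  (forall i, `|c i| <= i`!%:R^-1) ->
  continuous (fun x : R => limn (pseries c x)).
Proof.
move=> hc x; apply/differentiable_continuous/derivable1_diffP.
apply: ex_derive; apply: (@pseries_snd_diffs _ _ (`|x| + 1)).
- exact: pseries_inv_fact_cvg.
- exact/pseries_inv_fact_cvg/pseries_diffs_inv_fact_le.
- exact/pseries_inv_fact_cvg/pseries_diffs_inv_fact_le/pseries_diffs_inv_fact_le.
- by rewrite [ltRHS]ger0_norm // ltrDl.
Qed.

End Analysis.

(** * The alternating sign sequence *)

(** The coefficients of (1 - t) / (1 - t^(d+1)), the inverse of the generating
    function 1 + t + ... + t^d of the allowed run lengths. *)
Definition cyclic_sign (R : realType) (d e : nat) : R :=
  if (d.+1 %| e)%N then 1 else if (e %% d.+1 == 1)%N then -1 else 0.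

Section CyclicSign.
Context {R : realType} (d : nat) (d_gt0 : (0 < d)%N).
Local Notation sg := (cyclic_sign R d).

Lemma cyclic_signS m :
  sg m.+1 = if (d.+1 %| m.+1)%N then 1 else if (d.+1 %| m)%N then -1 else 0.
Proof.
by rewrite /cyclic_sign modnS; case: ifP => // ->; rewrite eqSS.
Qed.

Lemma cyclic_sign_norm e : `|sg e| <= 1.
Proof.
by rewrite /cyclic_sign; do 2?case: ifP => _; rewrite ?normrN ?normr1 ?normr0.
Qed.

(** The signs which are not zero alternate, so as for an alternating series a
    tail lies between 0 and its first term; which side depends on whether the
    next sign is that of an index 1 or 0 modulo d + 1. *)
Lemma alternating_tail (t : nat -> R) n m :
  (forall e, 0 <= t e) -> (forall e, (0 < e)%N -> t e.+1 <= t e) ->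
  let s := \sum_(e < n) sg (m.+1 + e) * t (m.+1 + e)%N in
  if (d.+1 %| m)%N then - t m.+1 <= s <= 0 else 0 <= s <= t m.+1.
Proof.
move=> t0 tdec /=; elim: n m => [|n IH] m.
  by rewrite big_ord0 lexx oppr_le0 !t0; case: ifP.
rewrite big_ord_recl addn0 cyclic_signS.
under eq_bigr => i _ do rewrite lift0 -addSnnS.
have := IH m.+1; set s := \sum_(i < n) _ => {}IH.
have tm := tdec m.+1 isT; have := t0 m.+1; have := t0 m.+2.
case: ifP IH => [dm1|_].
  have -> : (d.+1 %| m)%N = false.
    by apply/negP => dm; move: dm1; rewrite -(addn1 m) dvdn_addr // dvdn1; case: d d_gt0.
  by move=> /andP[h1 h2] h3 h4; apply/andP; split; lra.
move=> /andP[h1 h2] h3 h4; case: ifP => Hd; rewrite ?Hd; apply/andP; split; lra.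
Qed.

Lemma alternating_tail_le (t : nat -> R) n m :
  (forall e, 0 <= t e) -> (forall e, (0 < e)%N -> t e.+1 <= t e) ->
  `|\sum_(e < n) sg (m.+1 + e) * t (m.+1 + e)%N| <= t m.+1.
Proof.
move=> t0 tdec; have /= := alternating_tail n m t0 tdec; have := t0 m.+1.
by case: ifP => _ h /andP[h1 h2]; rewrite ler_norml; apply/andP; split; lra.
Qed.

Lemma sum_ord_split (f : nat -> R) m n :
  \sum_(e < m + n) f e = \sum_(e < m) f e + \sum_(e < n) f (m + e)%N.
Proof. by rewrite big_split_ord. Qed.

Lemma exp_term_decr (x : R) e : 0 <= x <= 2 -> (0 < e)%N ->
  x ^+ e.+1 / e.+1`!%:R <= x ^+ e / e`!%:R.
Proof.
move=> /andP[x0 x2] e0; rewrite exprS factS natrM invfM mulrACA.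
rewrite ler_piMl ?divr_ge0 ?exprn_ge0 // ler_pdivrMr ?ltr0n // mul1r.
by apply: le_trans x2 _; rewrite ler_nat.
Qed.

Lemma exp_term_ge0 (x : R) e : 0 <= x -> 0 <= x ^+ e / e`!%:R.
Proof. by move=> x0; rewrite divr_ge0 ?exprn_ge0. Qed.

(** Partial sums of the power series F whose inverse generates the f_k(m) / m!. *)
Definition root_sum (x : R) (m : nat) : R :=
  \sum_(e < m) sg e * (x ^+ e / e`!%:R).

Lemma root_sumD x m n : root_sum x (m + n) =
  root_sum x m + \sum_(e < n) sg (m + e) * (x ^+ (m + e) / (m + e)`!%:R).
Proof. exact: (sum_ord_split (fun e => sg e * (x ^+ e / e`!%:R))). Qed.

End CyclicSign.

Section Root.
Context {R : realType} (d : nat) (d_gt1 : (1 < d)%N).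
Import numFieldNormedType.Exports.
Local Open Scope classical_set_scope.
Local Notation sg := (cyclic_sign R d).

Let d_gt0 : (0 < d)%N := ltnW d_gt1.

Lemma root_sum_pseries (x : R) :
  root_sum d x = pseries (fun e => sg e / e`!%:R) x.
Proof.
apply/funext => m; rewrite /pseries /series /= big_mkord.
by apply: eq_bigr => e _; rewrite mulrA mulrAC.
Qed.

Lemma root_coef_le e : `|sg e / e`!%:R| <= e`!%:R^-1.
Proof.
rewrite normrM [`|_^-1|]ger0_norm ?invr_ge0 //.
by rewrite ler_piMl ?invr_ge0 // cyclic_sign_norm.
Qed.

Lemma root_sum_cvg (x : R) : cvgn (root_sum d x).
Proof. by rewrite root_sum_pseries; apply: pseries_inv_fact_cvg; exact: root_coef_le. Qed.

Lemma root_sum_tail_le (x : R) m n : 0 <= x <= 2 ->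
  `|root_sum d x (m.+1 + n) - root_sum d x m.+1| <= x ^+ m.+1 / m.+1`!%:R.
Proof.
move=> hx; rewrite root_sumD [_ + _ - _]addrAC subrr add0r.
apply: (@alternating_tail_le _ d d_gt0 (fun e => x ^+ e / e`!%:R)) => e.
  by apply: exp_term_ge0; case/andP: hx.
exact: exp_term_decr.
Qed.

Lemma root_sum_at1 N : (1 < N)%N -> 0 <= root_sum d (1 : R) N.
Proof.
move=> N1; rewrite -(subnKC N1) root_sumD.
have := @alternating_tail R d d_gt0 (fun e => 1 ^+ e / e`!%:R) (N - 2) 1.
have -> : (d.+1 %| 1)%N = false by rewrite dvdn1; case: d d_gt1.
move=> /= H; have /andP[H1 _] := H (fun e => exp_term_ge0 e ler01)
  (fun e e0 => @exp_term_decr R 1 e ltac:(lra) e0).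
rewrite /root_sum 2!big_ord_recr big_ord0 /= add0r.
have -> : sg 0 = 1 by [].
have -> : sg 1 = -1 by rewrite cyclic_signS dvdn1 dvdn0; case: d d_gt1.
by rewrite expr0 expr1 !divr1; lra.
Qed.

(** For d = 2 the partial sum of order 6 is needed, its value being about -0.026
    and the tail at most 0.0054; for larger d the order 4 is enough, since the
    terms of index 2 and 3 vanish and the tail is at most (5/4)^4 / 4!. *)
Lemma root_sum_at_five_quarters N : (5 < N)%N -> root_sum d (5 / 4 : R) N <= 0.
Proof.
move=> N5; set x : R := 5 / 4.
have hx : 0 <= x <= 2 by rewrite /x; apply/andP; split; lra.
have tail m n := @alternating_tail R d d_gt0 (fun e => x ^+ e / e`!%:R) n m
   (fun e => exp_term_ge0 e (proj1 (andP hx))) (fun e e0 => exp_term_decr hx e0).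
have sg0 : sg 0 = 1 by [].
have sg1 : sg 1 = -1 by rewrite cyclic_signS dvdn1 dvdn0; case: d d_gt1.
have [d2|d3] := eqVneq d 2.
  rewrite -(subnKC N5) root_sumD.
  have /= := tail 5 (N - 6)%N; rewrite d2 /= => /andP[_].
  set s := \sum_(e < _) _ => hs.
  rewrite /root_sum 6!big_ord_recr big_ord0 /= add0r.
  have -> : cyclic_sign R 2 0 = 1 by [].
  have -> : cyclic_sign R 2 1 = -1 by [].
  have -> : cyclic_sign R 2 2 = 0 by [].
  have -> : cyclic_sign R 2 3 = 1 by [].
  have -> : cyclic_sign R 2 4 = -1 by [].
  have -> : cyclic_sign R 2 5 = 0 by [].
  have -> : 1`! = 1%N by []. have -> : 3`! = 6%N by [].
  have -> : 4`! = 24%N by []. have f6 : 6`! = 720%N by [].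
  by move: hs; rewrite f6 fact0 /x !mul0r !exprS !expr0; lra.
have {}d3 : (2 < d)%N by lia.
rewrite -(subnKC (ltnW (ltnW N5))) root_sumD.
have /= := tail 3 (N - 4)%N.
have -> : (d.+1 %| 3)%N = false by apply/negP => /dvdn_leq; lia.
move=> /andP[_]; set s := \sum_(e < _) _ => hs.
rewrite /root_sum 4!big_ord_recr big_ord0 /= add0r sg0 sg1.
have -> : sg 2 = 0.
  rewrite cyclic_signS dvdn1; have -> : (d.+1 %| 2)%N = false by apply/negP => /dvdn_leq; lia.
  by case: d d_gt1.
have -> : sg 3 = 0.
  rewrite cyclic_signS; have -> : (d.+1 %| 2)%N = false by apply/negP => /dvdn_leq; lia.
  by have -> : (d.+1 %| 3)%N = false by apply/negP => /dvdn_leq; lia.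
have -> : 1`! = 1%N by []. have f4 : 4`! = 24%N by [].
by move: hs; rewrite f4 fact0 /x !mul0r !exprS !expr0; lra.
Qed.

(** The power series F changes sign between 1 and 5/4.  At a root, a partial
    sum is the opposite of its alternating tail, hence bounded by the first
    omitted term. *)
Lemma root_exists : exists2 x : R, 1 <= x <= 5 / 4 &
  forall m, `|root_sum d x m.+1| <= x ^+ m.+1 / m.+1`!%:R.
Proof.
pose F (x : R) := limn (root_sum d x).
have Fc : continuous F.
  rewrite (_ : F = fun x => limn (pseries (fun e => sg e / e`!%:R) x)).
    by apply: pseries_inv_fact_continuous; exact: root_coef_le.
  by apply/funext => x; rewrite /F root_sum_pseries.
have F1 : 0 <= F 1.
  apply: limr_ge; first exact: root_sum_cvg.
  by exists 2 => // N /= N2; apply: root_sum_at1.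
have F54 : F (5 / 4) <= 0.
  apply: limr_le; first exact: root_sum_cvg.
  by exists 6 => // N /= N6; apply: root_sum_at_five_quarters.
have [|x] := @IVT R F 1 (5 / 4) 0 ltac:(lra) (continuous_subspaceT Fc).
  by rewrite ge_min le_max F1 F54 orbT.
rewrite in_itv /= => hx Fx; exists x => // m.
have hx2 : 0 <= x <= 2 by apply/andP; move: hx => /andP[]; split; lra.
have c : (fun n => `|root_sum d x (n + m.+1) - root_sum d x m.+1|) @ \oo -->
    `|F x - root_sum d x m.+1|.
  apply: cvg_norm; apply: cvgB; last exact: cvg_cst.
  by rewrite (cvg_shiftn m.+1); exact: root_sum_cvg.
have -> : `|root_sum d x m.+1| = `|F x - root_sum d x m.+1| by rewrite Fx sub0r normrN.
rewrite -(cvg_lim _ c) //; apply: limr_le.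
  by apply/cvg_ex; exists `|F x - root_sum d x m.+1|.
by exists 0%N => // n _; rewrite addnC; apply: root_sum_tail_le.
Qed.

End Root.

(** * Inverting the run decomposition *)

Section Inversion.
Context {R : realType} (d : nat) (d_gt0 : (0 < d)%N).
Local Notation sg := (cyclic_sign R d).

Lemma cyclic_sum (h : nat -> R) J :
  \sum_(e < J * d.+1) sg e * h e =
  \sum_(j < J) (h (j * d.+1)%N - h (j * d.+1).+1).
Proof.
elim: J => [|J IH]; first by rewrite mul0n !big_ord0.
rewrite mulSnr (sum_ord_split (fun e => sg e * h e)) IH [RHS]big_ord_recr /=.
congr (_ + _).
have sgE s : (s < d.+1)%N -> sg (J * d.+1 + s) = if s == 0%N then 1 else if s == 1%N then -1 else 0.
  by move=> hs; rewrite /cyclic_sign /dvdn modnMDl modn_small.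
rewrite (bigD1 ord0) //= sgE // addn0 mul1r (bigD1 (lift ord0 (Ordinal d_gt0))) //=.
rewrite /bump /= addn0 sgE // mulN1r addn1 big1 ?addr0 // => i /andP[i0 i1].
rewrite sgE //; case: eqP => [e|_]; first by case/negP: i0; apply/eqP/val_inj.
case: eqP => [e|_]; last by rewrite mul0r.
by case/negP: i1; apply/eqP/val_inj; rewrite /= /bump /= addn0.
Qed.

(** Subtracting the hypotheses at e and e + 1 cancels all but two terms:
    f e - f (e + d + 1) = h e - h (e + 1). *)
Lemma cyclic_telescope (f h : nat -> R) :
  (forall e, \sum_(s < d.+1) f (e + s)%N = h e) ->
  forall J, \sum_(e < J * d.+1) sg e * h e = f 0%N - f (J * d.+1)%N.
Proof.
move=> H J; rewrite cyclic_sum; elim: J => [|J IH].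
  by rewrite big_ord0 mul0n subrr.
have Hd K : h K - h K.+1 = f K - f (K + d.+1)%N.
  rewrite -!H big_ord_recl [X in _ - X]big_ord_recr /= addn0 addSnnS.
  by under eq_bigr => i _ do rewrite /bump /= add1n -addSnnS; ring.
by rewrite big_ord_recr /= IH Hd mulSnr; ring.
Qed.

(** For fixed m and r the unknowns A (m - e) (r + e) form a single sequence in
    e, which vanishes for e > m, so that cyclic_telescope applies to it. *)
Lemma run_inversion (A B : nat -> nat -> R) :
  (forall m r, \sum_(s < d.+1) (if (s <= m)%N then A (m - s)%N (r + s)%N else 0)
     = B m r) ->
  forall m r, A m r = \sum_(e < m.+1) sg e * B (m - e)%N (r + e)%N.
Proof.
move=> H m r.
pose f e := if (e <= m)%N then A (m - e)%N (r + e)%N else 0.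
pose h e := if (e <= m)%N then B (m - e)%N (r + e)%N else 0.
have fh e : \sum_(s < d.+1) f (e + s)%N = h e.
  rewrite /h; case: leqP => em.
    rewrite -H; apply: eq_bigr => s _; rewrite /f leq_subRL //.
    by rewrite subnDA addnA.
  by rewrite big1 // => s _; rewrite /f leqNgt (leq_trans em) ?leq_addr.
have := cyclic_telescope fh m.+1.
have -> : f (m.+1 * d.+1)%N = 0 by rewrite /f leqNgt leq_pmulr.
rewrite {1}/f leq0n subn0 addn0 subr0 => <-.
rewrite (_ : m.+1 * d.+1 = m.+1 + m.+1 * d)%N; last by rewrite mulnS.
rewrite (sum_ord_split (fun e => sg e * h e)) [X in _ + X]big1 ?addr0.
  by apply: eq_bigr => i _; rewrite /h -ltnS ltn_ord.
by move=> i _; rewrite /h leqNgt ltnS leq_addr mulr0.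
Qed.

End Inversion.

(** * The probability of having no long decreasing run *)

(** This is f_k(m) / m! for k = d + 1. *)
Definition free_prob (R : realType) (d m : nat) : R :=
  if m is m'.+1 then free_sum d m' word_prob else 1.

Section FreeProb.
Context {R : realType} (d : nat) (d_gt1 : (1 < d)%N).
Local Notation sg := (cyclic_sign R d).
Local Notation u := (free_prob R d).

Let d_gt0 : (0 < d)%N := ltnW d_gt1.

Lemma free_prob_ge0 m : 0 <= u m.
Proof. by case: m => [|m] //=; apply: free_sum_ge0 => v; apply: word_prob_ge0. Qed.

Lemma rev_nseq_cons (T : Type) (x y : T) r v : rev (nseq r x ++ y :: v) = rev v ++ y :: nseq r x.
Proof. by rewrite rev_cat rev_cons rev_nseq -cats1 -catA. Qed.

(** The recursion for a gap followed by a run of r letters extends to r = 0 if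
    the value there is 1 for the empty gap and 0 otherwise: the equation for
    r = 0 is then the decomposition of a gap by its last run.  The claim is the
    inversion formula at r = 0. *)
Lemma free_prob_rec m :
  \sum_(e < m.+1) sg e * (u (m - e) / e`!%:R) = (m == 0%N)%:R.
Proof.
pose phi v : R := word_prob (rev v).
(* Here r counts letters, so r.+1 letters stand for r ones. *)
pose A m r : R := if r is r'.+1 then run_prefix_sum d phi m r' else (m == 0%N)%:R.
pose B m r : R := u m / r`!%:R.
suff H : forall m r, \sum_(s < d.+1)
    (if (s <= m)%N then A (m - s)%N (r + s)%N else 0) = B m r.
  by rewrite -[RHS]/(A m 0%N) (run_inversion d_gt0 H).
move=> {}m [|r]; last first.
  transitivity (\sum_(s < d.+1) (if (s <= m)%N then run_prefix_sum d phi (m - s) (r + s) else 0)).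
    by apply: eq_bigr.
  rewrite run_prefix_rec // /B /phi; case: m => [|m] /=.
    by rewrite rev_nseq word_prob_nseq div1r.
  rewrite -(@free_sum_rev _ d d_gt0 _ word_prob) -free_sumZr.
  apply: eq_free_sum => v _.
  by rewrite !rev_nseq_cons word_prob_split word_prob_nseq.
rewrite big_ord_recl /= /B divr1 subn0; case: m => [|m].
  by rewrite big1 ?addr0.
rewrite add0r /= -(@free_sum_rev _ d d_gt0 _ word_prob).
rewrite -[RHS]/(free_sum d m (fun v => phi (nseq 0 true ++ v))).
by rewrite free_sum_run.
Qed.

End FreeProb.

Section FreeProbAsymptotics.
Import numFieldNormedType.Exports.
Context {R : realType} (d : nat) (d_gt1 : (1 < d)%N).
Context (x : R) (hx : 1 <= x <= 5 / 4).
Context (root_le : forall m, `|root_sum d x m.+1| <= x ^+ m.+1 / m.+1`!%:R).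
Local Notation sg := (cyclic_sign R d).
Local Notation u := (free_prob R d).
Local Notation g m := (root_sum d x m.+1).

(** The inverse of the weight 6/5 for which root_sum_weighted_le holds. *)
Definition decay : R := 5 / 6.
Local Notation th := decay.

Definition scaled_prob m : R := u m * x ^+ m.
Local Notation y := scaled_prob.

Lemma decay_itv : 0 <= th < 1.
Proof. by rewrite /decay; apply/andP; split; lra. Qed.

Lemma scaled_prob_rec m :
  \sum_(e < m.+1) sg e * (x ^+ e / e`!%:R) * y (m - e) = (m == 0%N)%:R.
Proof.
transitivity (x ^+ m * \sum_(e < m.+1) sg e * (u (m - e) / e`!%:R)).
  rewrite mulr_sumr; apply: eq_bigr => e _.
  have -> : x ^+ m = x ^+ (m - e) * x ^+ e.
    by rewrite -exprD subnK // -ltnS.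
  by rewrite /y; ring.
by rewrite free_prob_rec //; case: m => [|m]; rewrite ?expr0 ?mul1r ?mulr0.
Qed.

(** Summation by parts of scaled_prob_rec: the partial sums of its right side
    are all equal to 1. *)
Lemma scaled_prob_sum m : \sum_(j < m.+1) g j * y (m - j) = 1.
Proof.
elim: m => [|m IH].
  have := scaled_prob_rec 0; rewrite !big_ord1 /root_sum big_ord1 => ->.
  by [].
rewrite -[RHS]IH -[RHS]add0r -[X in _ = X + _](scaled_prob_rec m.+1).
rewrite big_ord_recl [X in _ = X + _]big_ord_recl -addrA.
congr (_ + _); first by rewrite /root_sum big_ord1.
rewrite -big_split /=; apply: eq_bigr => i _.
rewrite /bump /= add1n subSS /root_sum [in LHS]big_ord_recr /=.
by rewrite mulrDl addrC.
Qed.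

Lemma root_sum_first_le : `|g 1| <= 1 / 4 /\ `|g 2| <= 1 / 4.
Proof.
have sg0 : sg 0 = 1 by [].
have sg1 : sg 1 = -1 by rewrite cyclic_signS dvdn1 dvdn0; case: d d_gt1.
have sg2 : sg 2 = 0.
  rewrite cyclic_signS dvdn1.
  have -> : (d.+1 %| 2)%N = false by apply/negP => /dvdn_leq; lia.
  by case: d d_gt1.
move: hx => /andP[h1 h2].
rewrite /root_sum !big_ord_recr !big_ord0 /= sg0 sg1 sg2 !expr0 !expr1 !mul0r !divr1.
by split; rewrite ler_norml; apply/andP; split; lra.
Qed.

(** The first two coefficients are at most x - 1 <= 1/4 and contribute at most
    0.66; from the third on the bound x^(j+1) / (j+1)! makes the terms decrease
    with ratio at most 3/10, because (6/5) x <= 3/2. *)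
Lemma root_sum_weighted_le n : \sum_(j < n) `|g j.+1| * (6 / 5) ^+ j.+1 <= 1.
Proof.
have [g1 g2] := root_sum_first_le.
suff H k : \sum_(j < k.+2) `|g j.+1| * (6 / 5) ^+ j.+1 <=
    66 / 100 + 26 / 100 * (1 - (3 / 10) ^+ k).
  have q0 k : 0 <= (3 / 10 : R) ^+ k by apply: exprn_ge0; lra.
  have mono k : \sum_(j < k) `|g j.+1| * (6 / 5) ^+ j.+1 <=
      \sum_(j < k.+2) `|g j.+1| * (6 / 5) ^+ j.+1.
    rewrite !big_ord_recr /= -addrA lerDl addr_ge0 // mulr_ge0 ?exprn_ge0 //; lra.
  by apply: le_trans (mono n) _; apply: le_trans (H n) _; have := q0 n; lra.
elim: k => [|k IH].
  rewrite !big_ord_recr big_ord0 /= expr0 expr1 expr2; lra.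
rewrite big_ord_recr /= [(3 / 10 : R) ^+ k.+1]exprS.
suff T : `|g k.+3| * (6 / 5) ^+ k.+3 <= 182 / 1000 * (3 / 10) ^+ k by lra.
have hz (z : R) : 0 <= z <= 3 / 2 -> z ^+ k.+4 / (k.+4)`!%:R <=
    (3 / 2) ^+ 4 / 24 * (3 / 10) ^+ k.
  move=> /andP[z0 z1]; elim: (k) => [|i IHi].
    rewrite expr0 mulr1 (_ : 4`! = 24)%N // ler_pM2r ?invr_gt0 ?ltr0n //.
    by rewrite lerXn2r ?nnegrE //; lra.
  have -> : (3 / 2 : R) ^+ 4 / 24 * (3 / 10) ^+ i.+1 =
      3 / 10 * ((3 / 2) ^+ 4 / 24 * (3 / 10) ^+ i).
    by rewrite [(3 / 10 : R) ^+ i.+1]exprS mulrCA.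
  rewrite exprS factS natrM invfM mulrACA.
  apply: ler_pM => //.
  - by rewrite divr_ge0.
  - by rewrite divr_ge0 ?exprn_ge0.
  - rewrite ler_pdivrMr ?ltr0n //.
    have : (5 : R) <= (i.+4.+1)%:R by rewrite ler_nat.
    lra.
have hxz : 0 <= x * (6 / 5) <= 3 / 2.
  by move: hx => /andP[h1 h2]; apply/andP; split; lra.
have p0 : 0 <= (6 / 5 : R) ^+ k.+3 by apply: exprn_ge0; lra.
apply: le_trans (ler_wpM2r p0 (root_le k.+3)) _.
have -> : x ^+ k.+4 / (k.+4)`!%:R * (6 / 5) ^+ k.+3 =
   (5 / 6) * ((x * (6 / 5)) ^+ k.+4 / (k.+4)`!%:R).
  by rewrite [(x * _) ^+ _]exprMn [(6 / 5 : R) ^+ k.+4]exprS; field; rewrite pnatr_eq0 -lt0n fact_gt0.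
have := hz _ hxz; set Q := _ ^+ k.+4 / _; have : 0 <= (3 / 10 : R) ^+ k by apply: exprn_ge0; lra.
rewrite !exprS !expr0; set P := (3 / 10) ^+ k; lra.
Qed.

(** The difference of two consecutive instances of scaled_prob_sum expresses an
    increment through the previous ones with coefficients g j, whose weighted
    sum is at most 1. *)
Lemma scaled_prob_step m : `|y m.+1 - y m| <= th ^+ m.+1.
Proof.
have y0 : y 0 = 1 by rewrite /y /= mulr1.
have g0 : g 0 = 1 by rewrite /root_sum big_ord1 /= expr0 divr1 mulr1.
elim/ltn_ind: m => m IH.
have E : y m.+1 - y m = - (\sum_(j < m) g j.+1 * (y (m - j) - y (m - j.+1)) + g m.+1).
  have := scaled_prob_sum m.+1; rewrite -(scaled_prob_sum m).
  rewrite big_ord_recr /= subnn y0 mulr1 !big_ord_recl /= !subn0 g0 !mul1r.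
  rewrite (eq_bigr (fun j : 'I_m => g j.+1 * (y (m - j)))).
    rewrite (_ : \sum_(i < m) _ * y (m - bump 0 i) = \sum_(i < m) g i.+1 * y (m - i.+1)).
      have -> : \sum_(j < m) g j.+1 * (y (m - j) - y (m - j.+1)) =
         \sum_(j < m) g j.+1 * y (m - j) - \sum_(j < m) g j.+1 * y (m - j.+1).
        by rewrite -sumrB; apply: eq_bigr => i _; rewrite mulrBr.
      by set a := \sum_(j < m) _; set b := \sum_(j < m) _; lra.
    by apply: eq_bigr => i _.
  by move=> i _; rewrite /bump /= add1n subSS.
rewrite E normrN.
apply: (@le_trans _ _ (\sum_(j < m.+1) `|g j.+1| * th ^+ (m - j))).
  rewrite big_ord_recr /= subnn expr0 mulr1; apply: le_trans (ler_normD _ _) _.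
  rewrite lerD2r; apply: le_trans (ler_norm_sum _ _ _) _; apply: ler_sum => j _.
  rewrite normrM ler_wpM2l // -(subnSK (ltn_ord j)); apply: IH.
  by have := ltn_ord j; lia.
have thE j : (j <= m)%N -> th ^+ (m - j) = th ^+ m.+1 * (6 / 5) ^+ j.+1.
  move=> jm; rewrite -[in RHS](subnK (jm : (j.+1 <= m.+1)%N)) subSS exprD -mulrA -exprMn.
  by rewrite (_ : th * _ = 1) ?expr1n ?mulr1 // /decay; field.
rewrite (eq_bigr (fun j : 'I_m.+1 => th ^+ m.+1 * (`|g j.+1| * (6 / 5) ^+ j.+1))).
  rewrite -mulr_sumr ler_piMr ?root_sum_weighted_le ?exprn_ge0 //.
  by case/andP: decay_itv.
by move=> j _; rewrite (thE j (ltn_ord j)) [LHS]mulrCA.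
Qed.

Lemma scaled_prob_cauchy N M : (N <= M)%N -> `|y M - y N| <= 5 * th ^+ N.
Proof.
move=> NM; suff H : `|y M - y N| <= 5 * (th ^+ N - th ^+ M).
  have : 0 <= th ^+ M by apply: exprn_ge0; case/andP: decay_itv.
  by move: H; lra.
elim: M NM => [|M IH]; first by rewrite leqn0 => /eqP ->; rewrite !subrr normr0 mulr0.
rewrite leq_eqVlt => /predU1P[->|NM]; first by rewrite !subrr normr0 mulr0.
have := IH NM; have := scaled_prob_step M.
have -> : y M.+1 - y N = (y M.+1 - y M) + (y M - y N) by rewrite addrA subrK.
have := ler_normD (y M.+1 - y M) (y M - y N).
have thE : th ^+ M.+1 = 5 / 6 * th ^+ M by rewrite exprS.
by rewrite thE; lra.
Qed.

Definition limit_prob : R := limn scaled_prob.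

Lemma scaled_prob_limit m : `|y m - limit_prob| <= 5 * th ^+ m.
Proof. exact: (geometric_limn decay_itv scaled_prob_cauchy). Qed.

(** A zero limit would make scaled_prob geometrically small, and then the sum
    in scaled_prob_sum would tend to 0 instead of being 1. *)
Lemma limit_prob_gt0 : 0 < limit_prob.
Proof.
have y_ge0 m : 0 <= y m.
  rewrite mulr_ge0 ?free_prob_ge0 ?exprn_ge0 //; move: hx => /andP[]; lra.
have [th0 th1] := andP decay_itv.
have c0 : 0 <= limit_prob.
  rewrite leNgt; apply/negP => cneg.
  have [|N /(_ N (leqnn N)) HN] := @geometric_small R 5 th (- limit_prob) decay_itv.
    by rewrite oppr_gt0.
  by have := scaled_prob_limit N; have := y_ge0 N; rewrite ler_norml => ? /andP[]; lra.
rewrite lt_neqAle c0 andbT eq_sym; apply/eqP => cz.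
have y_le m : `|y m| <= 5 * th ^+ m by have := scaled_prob_limit m; rewrite cz subr0.
have [N /(_ N (leqnn N)) HN] := @geometric_small R 10 th 1 decay_itv ltr01.
suff : 1 <= 10 * th ^+ N by lra.
rewrite -[leLHS](scaled_prob_sum N); apply: le_trans (ler_norm _) _.
apply: le_trans (ler_norm_sum _ _ _) _.
rewrite big_ord_recl /= subn0 {1}/root_sum big_ord1 expr0 divr1 mulr1 mul1r.
suff : \sum_(i < N) `|g (bump 0 i) * y (N - bump 0 i)| <= 5 * th ^+ N.
  by have := y_le N; lra.
apply: (@le_trans _ _ (5 * th ^+ N * \sum_(j < N) `|g j.+1| * (6 / 5) ^+ j.+1)).
  rewrite mulr_sumr; apply: ler_sum => j _; rewrite /bump /= add1n normrM.
  have -> : 5 * th ^+ N * (`|g j.+1| * (6 / 5) ^+ j.+1) = `|g j.+1| * (5 * th ^+ (N - j.+1)).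
    have eN : th ^+ N = th ^+ (N - j.+1) * th ^+ j.+1 by rewrite -exprD subnK.
    have e1 : th ^+ j.+1 * (6 / 5) ^+ j.+1 = 1.
      by rewrite -exprMn (_ : th * _ = 1) ?expr1n // /decay; field.
    rewrite eN -[RHS]mulr1 -[X in _ = _ * X]e1.
    by move: (th ^+ j.+1) (th ^+ (N - j.+1)) ((6 / 5 : R) ^+ j.+1) => p1 p2 p3; ring.
  by rewrite ler_wpM2l.
by rewrite ler_piMr ?root_sum_weighted_le // mulr_ge0 ?exprn_ge0.
Qed.

End FreeProbAsymptotics.

(** * The alternating transform *)

(** The probability of a run of r ones, which involves r + 1 letters. *)
Definition inv_fact (R : realType) (r : nat) : R := (r.+1`!%:R)^-1.

(** The limit of run_inversion for long gaps: if B (m, r) behaves like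
    b r / x^m, then A (m, r) behaves like alt_transform b r / x^m. *)
Definition alt_transform (R : realType) (d : nat) (x : R) (b : nat -> R) (r : nat) : R :=
  limn (fun N => \sum_(e < N) cyclic_sign R d e * x ^+ e * b (r + e)%N).

Section AltTransform.
Context {R : realType} (d : nat) (d_gt1 : (1 < d)%N).
Context (x : R) (hx : 1 <= x <= 5 / 4).
Import numFieldNormedType.Exports.
Local Open Scope classical_set_scope.
Local Notation sg := (cyclic_sign R d).
Local Notation om := (inv_fact R).
Local Notation th := (@decay R).
Local Notation tl := (alt_transform d x).

Let d_gt0 : (0 < d)%N := ltnW d_gt1.

(** Bounds the exponential series at (6/5) x <= 3/2. *)
Definition exp_bound : R := expR (3 / 2).
Local Notation E := exp_bound.

Lemma exp_bound_ge1 : 1 <= E.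
Proof. by rewrite /exp_bound -[leLHS]expR0 ler_expR; lra. Qed.

Lemma root_ge0 : 0 <= x. Proof. by move: hx => /andP[]; lra. Qed.

Lemma inv_fact_ge0 r : 0 <= om r.
Proof. by rewrite /inv_fact invr_ge0. Qed.

Lemma inv_factD r e : om (r + e)%N <= om r / e`!%:R.
Proof.
rewrite /inv_fact -invfM -natrM lef_pV2 ?posrE ?ltr0n ?muln_gt0 ?fact_gt0 //.
rewrite ler_nat -addSn -(bin_fact (leq_addl r.+1 e)) addnK [(e`! * _)%N]mulnC.
by rewrite leq_pmull // bin_gt0 leq_addl.
Qed.

Lemma inv_factD_le r e : om (r + e)%N <= om r.
Proof.
apply: le_trans (inv_factD r e) _; rewrite ler_piMr ?inv_fact_ge0 //.
by rewrite invf_le1 ?ltr0n ?fact_gt0 // ler1n fact_gt0.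
Qed.

Lemma inv_fact_le1 r : om r <= 1.
Proof. by rewrite /inv_fact invf_le1 ?ltr0n ?fact_gt0 // ler1n fact_gt0. Qed.

Lemma exp_weighted_le n : \sum_(e < n) (x * (6 / 5)) ^+ e / e`!%:R <= E.
Proof.
have hz : 0 <= x * (6 / 5) <= 3 / 2.
  by move: hx => /andP[h1 h2]; apply/andP; split; lra.
move: hz => /andP[z0 z1]; apply: le_trans (exp_partial_sum_le n z0) _.
by rewrite /exp_bound ler_expR.
Qed.

Lemma decay_inv e : th ^+ e * (6 / 5) ^+ e = 1.
Proof. by rewrite -exprMn (_ : th * _ = 1) ?expr1n // /decay; field. Qed.

Lemma decay_pow_ge0 e : 0 <= th ^+ e.
Proof. by rewrite exprn_ge0 //; case/andP: (@decay_itv R). Qed.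

Lemma decay_pow_le1 e : th ^+ e <= 1.
Proof. by have /andP[h0 h1] := @decay_itv R; rewrite exprn_ile1 // ltW. Qed.

Lemma decay_pow_mono e f : (e <= f)%N -> th ^+ f <= th ^+ e.
Proof.
move=> ef; rewrite -(subnK ef) exprD ler_piMl ?decay_pow_ge0 //.
exact: decay_pow_le1.
Qed.

(** The factorial in inv_factD beats the power (6/5)^e, which pays for the
    factor decay ^+ N. *)
Lemma sum_tail_le (b : nat -> R) (D : R) r N n : 0 <= D ->
  (forall r, `|b r| <= D * om r) ->
  `|\sum_(e < n) sg (N + e) * x ^+ (N + e) * b (r + (N + e))%N| <=
    D * E * om r * th ^+ N.
Proof.
move=> D0 hb; apply: le_trans (ler_norm_sum _ _ _) _.
apply: (@le_trans _ _ (D * om r * th ^+ N *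
   \sum_(e < N + n) (x * (6 / 5)) ^+ e / e`!%:R)); last first.
  rewrite [D * E * _]mulrAC [_ * E * _]mulrAC; apply: ler_wpM2l (exp_weighted_le _).
  by rewrite !mulr_ge0 ?inv_fact_ge0 ?decay_pow_ge0.
rewrite (sum_ord_split (fun e => (x * (6 / 5)) ^+ e / e`!%:R)) mulrDr.
apply: (@le_trans _ _ (D * om r * th ^+ N *
   \sum_(e < n) (x * (6 / 5)) ^+ (N + e) / (N + e)`!%:R)); last first.
  rewrite lerDr !mulr_ge0 ?inv_fact_ge0 ?decay_pow_ge0 //.
  apply: sumr_ge0 => e _; rewrite divr_ge0 ?exprn_ge0 // mulr_ge0 ?root_ge0 //; lra.
rewrite mulr_sumr; apply: ler_sum => e _; rewrite !normrM.
rewrite [`|x ^+ _|]ger0_norm ?exprn_ge0 ?root_ge0 //.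
have x0 := exprn_ge0 (N + e) root_ge0.
apply: (@le_trans _ _ (x ^+ (N + e) * (D * (om r / (N + e)`!%:R)))).
  apply: (@le_trans _ _ (x ^+ (N + e) * `|b (r + (N + e))%N|)).
    by rewrite -mulrA ler_piMl ?cyclic_sign_norm ?mulr_ge0.
  rewrite ler_wpM2l //; apply: le_trans (hb _) _.
  by rewrite ler_wpM2l // inv_factD.
have -> : D * om r * th ^+ N * ((x * (6 / 5)) ^+ (N + e) / (N + e)`!%:R) =
   (th ^+ N * (6 / 5) ^+ N) * (6 / 5) ^+ e * (x ^+ (N + e) * (D * (om r / (N + e)`!%:R))).
  by rewrite [(x * _) ^+ _]exprMn [(6 / 5 : R) ^+ (N + e)]exprD; ring.
rewrite decay_inv mul1r ler_peMl ?mulr_ge0 ?inv_fact_ge0 ?invr_ge0 //.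
by rewrite exprn_ege1 //; lra.
Qed.

Section Bounded.
Context (b : nat -> R) (D : R).
Context (D0 : 0 <= D) (hb : forall r, `|b r| <= D * om r).

Let S r N := \sum_(e < N) sg e * x ^+ e * b (r + e)%N.

Lemma alt_sum_cauchy r N M : (N <= M)%N ->
  `|S r M - S r N| <= D * E * om r * th ^+ N.
Proof.
move=> NM; rewrite /S -(subnKC NM).
rewrite (sum_ord_split (fun e => sg e * x ^+ e * b (r + e)%N)) addrAC subrr add0r.
exact: sum_tail_le.
Qed.

Lemma alt_transform_tail r N :
  `|\sum_(e < N) sg e * x ^+ e * b (r + e)%N - tl b r| <= D * E * om r * th ^+ N.
Proof. exact: (geometric_limn (@decay_itv R) (@alt_sum_cauchy r)). Qed.

Lemma alt_transform_cvg r :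
  (fun N => \sum_(e < N) sg e * x ^+ e * b (r + e)%N) @ \oo --> tl b r.
Proof. exact: (limn_eq_geometric (@decay_itv R) (alt_transform_tail r)). Qed.

Lemma alt_transform_le r : `|tl b r| <= D * E * om r.
Proof.
by have := alt_transform_tail r 0; rewrite big_ord0 sub0r normrN expr0 mulr1.
Qed.

(** Grouping the terms of index j (d+1) and j (d+1) + 1 makes every group
    nonnegative; the lower bound is the first group. *)
Lemma alt_transform_ge r :
  (forall j, x * b (r + j).+1 <= b (r + j)%N) ->
  b r - x * b r.+1 <= tl b r.
Proof.
move=> H; rewrite leNgt; apply/negP; rewrite -subr_gt0 => lt.
have [N HN] := @geometric_small R (D * E * om r) th _ (@decay_itv R) lt.
have hN : (N <= N.+1 * d.+1)%N by rewrite (leq_trans (leqnSn N)) // leq_pmulr.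
have := HN _ hN; have := alt_transform_tail r (N.+1 * d.+1).
rewrite (eq_bigr (fun e : 'I__ => sg e * (x ^+ e * b (r + e)%N))); last first.
  by move=> e _; rewrite mulrA.
rewrite (@cyclic_sum R d d_gt0 (fun e => x ^+ e * b (r + e)%N)).
rewrite big_ord_recl /= mul0n !addn0 expr0 expr1 mul1r addn1 ler_norml.
set s := \sum_(i < N) _.
have s0 : 0 <= s.
  apply: sumr_ge0 => i _; set j := (_ * _)%N.
  rewrite exprSr -mulrA -mulrBr mulr_ge0 ?exprn_ge0 ?root_ge0 //.
  by rewrite subr_ge0 addnS H.
by move=> /andP[_ h1] h2; lra.
Qed.

End Bounded.

Lemma alt_transform_lin (b b' : nat -> R) (D D' a a' : R) r :
  0 <= D -> (forall r, `|b r| <= D * om r) ->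
  0 <= D' -> (forall r, `|b' r| <= D' * om r) ->
  tl (fun r => a * b r + a' * b' r) r = a * tl b r + a' * tl b' r.
Proof.
move=> D0 hb D0' hb'; apply: cvg_lim => //.
have -> : (fun N => \sum_(e < N) sg e * x ^+ e * (a * b (r + e)%N + a' * b' (r + e)%N)) =
  (fun N => a * (\sum_(e < N) sg e * x ^+ e * b (r + e)%N) +
            a' * (\sum_(e < N) sg e * x ^+ e * b' (r + e)%N)).
  apply/funext => N; rewrite !mulr_sumr -big_split; apply: eq_bigr => e _ /=; ring.
by apply: cvgD; apply: cvgM;
  [exact: cvg_cst | exact: (alt_transform_cvg D0 hb) |
   exact: cvg_cst | exact: (alt_transform_cvg D0' hb')].
Qed.

Lemma alt_transformZ (b : nat -> R) (D a : R) r :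
  0 <= D -> (forall r, `|b r| <= D * om r) ->
  tl (fun r => a * b r) r = a * tl b r.
Proof.
move=> D0 hb; have := alt_transform_lin a 0 r D0 hb D0 hb; rewrite mul0r addr0 => <-.
by congr alt_transform; apply/funext => s; rewrite mul0r addr0.
Qed.

Lemma alt_transform_shift (b : nat -> R) r :
  tl (fun r => b r.+1) r = tl b r.+1.
Proof. by rewrite /alt_transform; congr (lim (_ @ _)). Qed.

(** The finite sum up to m differs from the transform of b by the accumulated
    error of B, damped by factorials, and by the tail beyond m, which is
    geometrically small in m. *)
Lemma run_inversion_asymptotics (A B : nat -> nat -> R) (b : nat -> R) (D eps K : R) :
  0 <= D -> 0 <= eps -> 0 <= K ->
  (forall m r, \sum_(s < d.+1) (if (s <= m)%N then A (m - s)%N (r + s)%N else 0)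
     = B m r) ->
  (forall r, `|b r| <= D * om r) ->
  (forall m r, `|B m r * x ^+ m - b r| <= (eps + K * th ^+ m) * om r) ->
  forall m r, `|A m r * x ^+ m - tl b r| <= E * (eps + (K + D) * th ^+ m) * om r.
Proof.
move=> D0 e0 K0 HA hb HB m r.
have om0 := inv_fact_ge0 r; have xp e := exprn_ge0 e root_ge0.
pose Q := \sum_(e < m.+1) sg e * x ^+ e * b (r + e)%N.
have -> : A m r * x ^+ m - tl b r = (A m r * x ^+ m - Q) + (Q - tl b r).
  by rewrite addrA subrK.
apply: le_trans (ler_normD _ _) _.
have h2 : `|Q - tl b r| <= D * E * om r * th ^+ m.
  apply: le_trans (alt_transform_tail D0 hb r m.+1) _.
  rewrite ler_wpM2l ?mulr_ge0 ?(le_trans ler01 exp_bound_ge1) //.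
  exact: decay_pow_mono.
suff h1 : `|A m r * x ^+ m - Q| <= E * (eps + K * th ^+ m) * om r.
  apply: le_trans (lerD h1 h2) _; rewrite le_eqVlt; apply/orP; left; apply/eqP; ring.
have -> : A m r * x ^+ m - Q =
  \sum_(e < m.+1) sg e * x ^+ e * (B (m - e)%N (r + e)%N * x ^+ (m - e) - b (r + e)%N).
  rewrite (run_inversion d_gt0 HA) mulr_suml /Q -sumrB; apply: eq_bigr => e _.
  have -> : x ^+ m = x ^+ (m - e) * x ^+ e by rewrite -exprD subnK // -ltnS.
  ring.
apply: le_trans (ler_norm_sum _ _ _) _.
apply: (@le_trans _ _ ((eps + K * th ^+ m) * om r *
   \sum_(e < m.+1) (x * (6 / 5)) ^+ e / e`!%:R)); last first.
  rewrite -[leRHS]mulrA [leRHS]mulrC; apply: ler_wpM2l (exp_weighted_le _).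
  by rewrite mulr_ge0 // addr_ge0 // mulr_ge0 ?decay_pow_ge0.
rewrite mulr_sumr; apply: ler_sum => e _; rewrite !normrM.
rewrite [`|x ^+ _|]ger0_norm //.
have em : (e <= m)%N by rewrite -ltnS.
apply: (@le_trans _ _ (x ^+ e * ((eps + K * th ^+ (m - e)) * (om r / e`!%:R)))).
  apply: (@le_trans _ _ (x ^+ e *
     `|B (m - e)%N (r + e)%N * x ^+ (m - e) - b (r + e)%N|)).
    by rewrite -mulrA ler_piMl ?cyclic_sign_norm ?mulr_ge0.
  rewrite ler_wpM2l //; apply: le_trans (HB _ _) _.
  by rewrite ler_wpM2l ?inv_factD // addr_ge0 // mulr_ge0 ?decay_pow_ge0.
have -> : (eps + K * th ^+ m) * om r * ((x * (6 / 5)) ^+ e / e`!%:R) =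
  x ^+ e * ((eps * (6 / 5) ^+ e + K * (th ^+ m * (6 / 5) ^+ e)) * (om r / e`!%:R)).
  by rewrite [(x * _) ^+ _]exprMn; ring.
have -> : th ^+ m * (6 / 5) ^+ e = th ^+ (m - e).
  by rewrite -{1}(subnK em) exprD -mulrA decay_inv mulr1.
rewrite ler_wpM2l // ler_wpM2r ?divr_ge0 // lerD2r ler_peMr //.
by rewrite exprn_ege1 //; lra.
Qed.

Local Notation tau := (tl om).

(** The two nested transforms come from the gaps on both sides of a prescribed
    run of d ones. *)
Definition junction_const : R := tl tau d.

Lemma inv_fact_bound r : `|om r| <= 1 * om r.
Proof. by rewrite mul1r ger0_norm ?inv_fact_ge0. Qed.

Lemma tau_bound r : `|tau r| <= E * om r.
Proof. by have := alt_transform_le ler01 inv_fact_bound r; rewrite mul1r. Qed.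

Lemma inv_fact_convex r : (1 < r)%N -> 0 < om r - 2 * x * om r.+1.
Proof.
move=> r1; rewrite /inv_fact (factS r.+1) natrM invfM subr_gt0.
rewrite mulrA gtr_pMl ?invr_gt0 ?ltr0n ?fact_gt0 // ltr_pdivrMr ?ltr0n // mul1r.
have : (4 : R) <= r.+2%:R by rewrite ler_nat.
by move: hx => /andP[]; lra.
Qed.

(** alt_transform_ge is used twice.  The double difference it produces is
    om r - 2 x om (r+1) + x^2 om (r+2), positive for r >= 2 because
    2 x <= 5/2 < r + 2. *)
Lemma junction_const_gt0 : 0 < junction_const.
Proof.
have E0 : 0 <= E := le_trans ler01 exp_bound_ge1.
have x0 := root_ge0.
have omS r : `|om r.+1| <= 1 * om r.
  by rewrite mul1r ger0_norm ?inv_fact_ge0 // -addn1 inv_factD_le.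
pose q r := 1 * om r + (- x) * om r.+1.
have qb r : `|q r| <= (1 + x) * om r.
  rewrite /q; apply: le_trans (ler_normD _ _) _; rewrite mulrDl.
  apply: lerD; first by rewrite !mul1r ger0_norm ?inv_fact_ge0.
  rewrite normrM normrN (ger0_norm x0) ler_wpM2l //.
  by have := omS r; rewrite mul1r.
have tauq r : tau r - x * tau r.+1 = tl q r.
  rewrite -alt_transform_shift /q (alt_transform_lin _ _ _ ler01 inv_fact_bound ler01 omS).
  by rewrite mul1r mulNr.
have qpos r : (1 < r)%N -> 0 < q r - x * q r.+1.
  move=> r1; have := inv_fact_convex r1; rewrite /q.
  have : 0 <= x * x * om r.+2 by rewrite !mulr_ge0 ?inv_fact_ge0.
  lra.
have tauq_gt0 r : (1 < r)%N -> 0 < tau r - x * tau r.+1.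
  move=> r1; rewrite tauq; apply: lt_le_trans (qpos r r1) _.
  apply: (alt_transform_ge _ qb); first by lra.
  move=> j; have := qpos (r + j)%N ltac:(lia); lra.
apply: lt_le_trans (tauq_gt0 d d_gt1) _.
apply: (alt_transform_ge E0 tau_bound) => j.
by have := tauq_gt0 (d + j)%N ltac:(lia); lra.
Qed.

End AltTransform.

(** * Crossing one prescribed run *)

(** Inherited from word_prob by every sum over what stands on the left of a
    word; it is all that the analysis of the remaining word uses. *)
Definition right_multiplicative (R : realType) (delta : seq bool -> R) : Prop :=
  forall v w, delta (v ++ false :: w) + delta (v ++ true :: w) =
    delta v * word_prob w.

Section Contexts.
Context {R : realType} (d : nat) (d_gt1 : (1 < d)%N).
Context (x : R) (hx : 1 <= x <= 5 / 4).
Context (root_le : forall m, `|root_sum d x m.+1| <= x ^+ m.+1 / m.+1`!%:R).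
Local Notation u := (free_prob R d).
Local Notation om := (inv_fact R).
Local Notation th := (@decay R).
Local Notation tl := (alt_transform d x).
Local Notation tau := (tl om).
Local Notation E := (@exp_bound R).
Local Notation c := (limit_prob d x).
Local Notation S := (junction_const d x).

Let d_gt0 : (0 < d)%N := ltnW d_gt1.

(** Normalised by a power of x, a context is summarised by the number alpha to
    which the weight of a following long gap tends.  The last condition controls
    the empty gap, where the run on its left meets the next one. *)
Definition context_ok (delta : seq bool -> R) (alpha eps K : R) : Prop :=
  [/\ right_multiplicative delta,
      forall m, `|free_sum d m delta * x ^+ m.+1 - alpha| <= eps + K * th ^+ m.+1 &
      forall r, `|delta (nseq r true)| <= K * om r].

Lemma context_ok_mono delta alpha eps K eps' K' : eps <= eps' -> K <= K' ->
  context_ok delta alpha eps K -> context_ok delta alpha eps' K'.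
Proof.
move=> he hK [h1 h2 h3]; split=> // [m|r].
  by apply: le_trans (h2 m) _; rewrite lerD // ler_wpM2r ?decay_pow_ge0.
by apply: le_trans (h3 r) _; rewrite ler_wpM2r ?inv_fact_ge0.
Qed.

Lemma word_prob_context_ok : context_ok word_prob c 0 5.
Proof.
split=> [v w|m|r]; first exact: word_prob_split.
  by rewrite add0r; exact: (scaled_prob_limit d_gt1 hx root_le m.+1).
have om0 := inv_fact_ge0 (R := R) r.
rewrite word_prob_nseq -/(om r) ger0_norm //; lra.
Qed.

Section Step.
Context (delta : seq bool -> R) (alpha eps K : R).
Context (alpha0 : 0 <= alpha) (eps0 : 0 <= eps) (K0 : 0 <= K).
Context (ok : context_ok delta alpha eps K) (b : nat).

Let run_context w : R := x ^+ b.+1 * free_sum d b (fun v => delta (v ++ false :: w)).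
Let step_error := E * (eps + (K + alpha + alpha) * th ^+ b.+1).

Lemma run_context_multiplicative : right_multiplicative run_context.
Proof.
have [dm _ _] := ok; move=> v w; rewrite /run_context -mulrDr -free_sumD -mulrA -free_sumZr.
congr (_ * _); apply: eq_free_sum => z _.
by rewrite -!cat_cons !catA dm.
Qed.

Lemma step_error_ge0 : 0 <= step_error.
Proof.
have E1 := @exp_bound_ge1 R.
by rewrite /step_error mulr_ge0 ?addr_ge0 ?mulr_ge0 ?addr_ge0 ?decay_pow_ge0 //; lra.
Qed.

(** First inversion: the gap against the run on its right.  Reversing the words
    reduces it to run_prefix_rec. *)
Lemma run_context_nseq r : `|run_context (nseq r true) - alpha * tau r| <= step_error * om r.
Proof.
have [dm dU dr] := ok.
pose phi v : R := delta (rev v).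
pose B m r : R := if m is m'.+1 then free_sum d m' delta * om r
                  else delta (nseq r true).
have HA m s : \sum_(t < d.+1)
    (if (t <= m)%N then run_prefix_sum d phi (m - t) (s + t) else 0) = B m s.
  rewrite run_prefix_rec // /phi /B; case: m => [|m]; first by rewrite rev_nseq.
  rewrite -(@free_sum_rev _ d d_gt0 _ delta) -free_sumZr; apply: eq_free_sum => v _.
  by rewrite !rev_nseq_cons dm word_prob_nseq.
have hb s : `|alpha * om s| <= alpha * om s.
  by rewrite ger0_norm // mulr_ge0 ?inv_fact_ge0.
have HB m s : `|B m s * x ^+ m - alpha * om s| <= (eps + (K + alpha) * th ^+ m) * om s.
  have om0 := inv_fact_ge0 (R := R) s.
  case: m => [|m] /=.
    rewrite !expr0 !mulr1; apply: le_trans (ler_normB _ _) _.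
    by apply: le_trans (lerD (dr s) (hb s)) _; rewrite -mulrDl ler_wpM2r // lerDr.
  have -> : free_sum d m delta * om s * x ^+ m.+1 - alpha * om s =
     (free_sum d m delta * x ^+ m.+1 - alpha) * om s by ring.
  rewrite normrM (ger0_norm om0) ler_wpM2r //; apply: le_trans (dU m) _.
  by rewrite lerD2l ler_wpM2r ?decay_pow_ge0 // lerDl.
have Ka : 0 <= K + alpha by rewrite addr_ge0.
have := run_inversion_asymptotics d_gt1 hx alpha0 eps0 Ka HA hb HB b.+1 r.
rewrite (@alt_transformZ _ d _ hx _ 1) //; last exact: inv_fact_bound.
rewrite /= mulrC; congr (`|_ - _| <= _); congr (_ * _).
rewrite -(@free_sum_rev _ d d_gt0 _ (fun v => delta (v ++ _))).
by apply: eq_free_sum => v _; rewrite /phi rev_nseq_cons.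
Qed.

Lemma run_context_nseq_le r : `|run_context (nseq r true)| <= (step_error + alpha * E) * om r.
Proof.
rewrite -[run_context _](subrK (alpha * tau r)); apply: le_trans (ler_normD _ _) _.
rewrite mulrDl; apply: lerD (run_context_nseq r) _.
by rewrite normrM (ger0_norm alpha0) -mulrA ler_wpM2l // tau_bound.
Qed.

(** Second inversion: the run against the gap on its right, with the asymptotics
    of run_context_nseq and of the gap probabilities as input. *)
Lemma context_ok_next :
  context_ok (fun w => x ^+ b.+1 * next_context d b delta w) (c * alpha * S)
    (E * ((c + 5) * step_error))
    (E * (5 * (alpha * E) + c * alpha * E) + 2 * (step_error + alpha * E)).
Proof.
have E1 := @exp_bound_ge1 R; have c0 := limit_prob_gt0 d_gt1 hx root_le; have e0 := step_error_ge0.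
have aE : 0 <= alpha * E by rewrite mulr_ge0 //; lra.
have caE : 0 <= c * alpha * E by rewrite !mulr_ge0 //; lra.
have gm := run_context_multiplicative.
split=> [v w|m|r].
- by have := gm (nseq d true ++ false :: v) w; rewrite -!catA.
- have HA n s : \sum_(t < d.+1)
      (if (t <= n)%N then run_prefix_sum d run_context (n - t) (s + t) else 0) =
      run_context (nseq s true) * u n.
    rewrite run_prefix_rec //; case: n => [|n] /=; first by rewrite mulr1.
    by rewrite -free_sumZ; apply: eq_free_sum => v _; rewrite gm.
  have hb s : `|c * alpha * tau s| <= c * alpha * E * om s.
    rewrite normrM ger0_norm; last by rewrite mulr_ge0 // ltW.
    by rewrite -[leRHS]mulrA ler_wpM2l ?tau_bound // mulr_ge0 // ltW.
  (* Z y - c alpha tau = (Z - alpha tau) y + alpha tau (y - c). *)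
  have HB n s : `|run_context (nseq s true) * u n * x ^+ n - c * alpha * tau s| <=
      ((c + 5) * step_error + 5 * (alpha * E) * th ^+ n) * om s.
    have om0 := inv_fact_ge0 (R := R) s.
    have hy := scaled_prob_limit d_gt1 hx root_le n.
    rewrite /scaled_prob in hy; set y := u n * x ^+ n in hy.
    have hy5 : `|y| <= c + 5.
      rewrite -[y](subrK c) [c + 5]addrC; apply: le_trans (ler_normD _ _) _.
      apply: lerD; last by rewrite ger0_norm // ltW.
      apply: le_trans hy _.
      by rewrite ler_piMr // decay_pow_le1.
    have -> : run_context (nseq s true) * u n * x ^+ n - c * alpha * tau s =
        (run_context (nseq s true) - alpha * tau s) * y + alpha * tau s * (y - c).
      by rewrite /y; ring.
    clearbody y; apply: le_trans (ler_normD _ _) _; rewrite !normrM mulrDl; apply: lerD.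
      have -> : (c + 5) * step_error * om s = step_error * om s * (c + 5) by ring.
      by apply: ler_pM => //; exact: run_context_nseq.
    have -> : 5 * (alpha * E) * th ^+ n * om s = alpha * (E * om s) * (5 * th ^+ n) by ring.
    by apply: ler_pM => //; rewrite ?mulr_ge0 // (ger0_norm alpha0) ler_wpM2l ?tau_bound.
  have h1 : 0 <= (c + 5) * step_error by rewrite mulr_ge0 // addr_ge0 // ltW.
  have h2 : 0 <= 5 * (alpha * E) by rewrite mulr_ge0.
  have := run_inversion_asymptotics d_gt1 hx caE h1 h2 HA hb HB m.+1 d.
  have E0 : 0 <= E by lra.
  rewrite (@alt_transformZ _ d _ hx _ E) //; last exact: tau_bound.
  rewrite -/S => H; apply: le_trans H _.
  apply: (@le_trans _ _ (E * ((c + 5) * step_error + (5 * (alpha * E) + c * alpha * E) * th ^+ m.+1))).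
    rewrite ler_piMr ?inv_fact_le1 // mulr_ge0 // addr_ge0 //.
    by rewrite mulr_ge0 ?addr_ge0 ?decay_pow_ge0.
  rewrite mulrDr lerD2l mulrA ler_wpM2r ?decay_pow_ge0 // lerDl.
  by rewrite mulr_ge0 // addr_ge0.
- have om0 := inv_fact_ge0 (R := R) r.
  have A0 : 0 <= step_error + alpha * E by rewrite addr_ge0.
  have -> : x ^+ b.+1 * next_context d b delta (nseq r true) =
      run_context (nseq d true) * om r - run_context (nseq (d + r.+1) true).
    have := gm (nseq d true) (nseq r true); rewrite word_prob_nseq -/(om r) => <-.
    by rewrite nseqD addrK.
  apply: le_trans (ler_normB _ _) _.
  apply: (@le_trans _ _ (2 * (step_error + alpha * E) * om r)); last first.
    rewrite ler_wpM2r // lerDr mulr_ge0 ?addr_ge0 ?mulr_ge0 //; lra.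
  have -> : 2 * (step_error + alpha * E) * om r = (step_error + alpha * E) * om r + (step_error + alpha * E) * om r.
    by ring.
  apply: lerD.
    rewrite normrM (ger0_norm om0) ler_wpM2r //; apply: le_trans (run_context_nseq_le d) _.
    by rewrite ler_piMr ?inv_fact_le1.
  apply: le_trans (run_context_nseq_le _) _; rewrite ler_wpM2l //.
  by rewrite addnC addSnnS inv_factD_le.
Qed.

End Step.

Lemma gap_sumZ bs b (kappa : R) (delta : seq bool -> R) :
  gap_sum d b bs (fun w => kappa * delta w) = kappa * gap_sum d b bs delta.
Proof.
elim: bs b delta => [|b' bs IH] b delta /=; first exact: free_sumZ.
rewrite -IH; congr gap_sum; apply/funext => w; exact: free_sumZ.
Qed.

Local Notation X := (x ^+ d.+1).

(** The constant C is chosen before q and the gaps: it only depends on the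
    number of runs and on the bounds for the initial context. *)
Lemma gap_sum_asymptotics a : forall alpha e0 K0, 0 <= alpha -> 0 <= e0 -> 0 <= K0 ->
  exists2 C, 0 <= C & forall q b bs delta, size bs = a ->
    all (fun b' => (q <= b'.+1)%N) (b :: bs) ->
    context_ok delta alpha (e0 * th ^+ q) K0 ->
    `|gap_sum d b bs delta * x ^+ (gap_size d b bs).+1 - alpha * (c * S * X) ^+ a|
      <= C * th ^+ q.
Proof.
have E1 := @exp_bound_ge1 R; have c0 := limit_prob_gt0 d_gt1 hx root_le; have x0 := root_ge0 hx.
have S0 : 0 < S := junction_const_gt0 d_gt1 hx.
elim: a => [|a IH] alpha e0 K0 alpha0 e00 K00.
  exists (e0 + K0); first by rewrite addr_ge0.
  move=> q b [|//] delta _ /= /andP[qb _] [_ dU _].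
  rewrite mulr1; apply: le_trans (dU b) _; rewrite mulrDl lerD2l ler_wpM2l //.
  exact: decay_pow_mono.
pose M := E * (e0 + (K0 + alpha + alpha)).
have M0 : 0 <= M by rewrite /M mulr_ge0 ?addr_ge0 //; lra.
have aE : 0 <= alpha * E by rewrite mulr_ge0 //; lra.
have [|||C C0 HC] := IH (c * alpha * S) (E * ((c + 5) * M))
   (E * (5 * (alpha * E) + c * alpha * E) + 2 * (M + alpha * E)).
- by rewrite !mulr_ge0 // ltW.
- rewrite !mulr_ge0 ?addr_ge0 //; lra.
- by rewrite addr_ge0 ?mulr_ge0 ?addr_ge0 ?mulr_ge0 //; lra.
exists (X * C); first by rewrite mulr_ge0 ?exprn_ge0.
move=> q b [//|b' bs] delta [sbs] /= /andP[qb qbs] ok.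
have th0 := decay_pow_ge0 (R := R) q.
have e10 : 0 <= e0 * th ^+ q by rewrite mulr_ge0.
have hM : E * (e0 * th ^+ q + (K0 + alpha + alpha) * th ^+ b.+1) <= M * th ^+ q.
  have -> : M * th ^+ q = E * (e0 * th ^+ q + (K0 + alpha + alpha) * th ^+ q).
    by rewrite /M; ring.
  apply: ler_wpM2l; first by lra.
  by rewrite lerD2l ler_wpM2l ?addr_ge0 // decay_pow_mono.
have hM1 : E * (e0 * th ^+ q + (K0 + alpha + alpha) * th ^+ b.+1) <= M.
  by apply: le_trans hM _; rewrite ler_piMr // decay_pow_le1.
have {}ok := context_ok_next alpha0 e10 K00 ok b.
have {}ok := context_ok_mono _ _ ok.
have := HC q b' bs _ sbs qbs (ok _ _ _ _).
have Ege0 : 0 <= E by lra.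
have c5 : 0 <= c + 5 by lra.
rewrite -[E * _ * th ^+ q]mulrA -[(c + 5) * M * _]mulrA.
move=> /(_ (ler_wpM2l Ege0 (ler_wpM2l c5 hM))).
have h2 : 2 * (E * (e0 * th ^+ q + (K0 + alpha + alpha) * th ^+ b.+1) + alpha * E) <=
   2 * (M + alpha * E) by rewrite ler_wpM2l // lerD2r.
move=> /(_ (lerD (lexx _) h2)).
rewrite gap_sumZ => H.
have -> : gap_sum d b' bs (next_context d b delta) *
     x ^+ (b + (d + (gap_size d b' bs).+1).+1).+1 - alpha * (c * S * X) ^+ a.+1 =
  X * (x ^+ b.+1 * gap_sum d b' bs (next_context d b delta) *
     x ^+ (gap_size d b' bs).+1 - c * alpha * S * (c * S * X) ^+ a).
  rewrite -addSn -addSn !exprD [(c * S * X) ^+ _]exprS; ring.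
by rewrite normrM (ger0_norm (exprn_ge0 d.+1 x0)) -[leRHS]mulrA ler_wpM2l ?exprn_ge0.
Qed.

End Contexts.

(** * Counting permutations with square root gaps *)

Section Counting.
Context {R : realType} (d : nat) (d_gt1 : (1 < d)%N).

Let d_gt0 : (0 < d)%N := ltnW d_gt1.

Lemma fcountE N : (fcount d.+1 N.+1)%:R = N.+1`!%:R * free_prob R d N.+1 :> R.
Proof.
rewrite /fcount (@dcountE R d N _ xpred0) // => [|i]; last by rewrite inE.
by congr (_ * _); apply: eq_sum_words => v _; rewrite windows_at_nil.
Qed.

Lemma dcount_gap_sum a N q (i : 'I_a -> 'I_N.+1) (I : {set 'I_N.+1}) :
  let ps := [seq nat_of_ord (i j) | j <- enum 'I_a] in
  (forall p, (p \in I) = (nat_of_ord p \in ps)) ->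
  (0 < q)%N -> gaps_at_least d N.+1 q 0 ps ->
  (dcount d.+1 I)%:R =
  N.+1`!%:R * gap_sum d (first_gap N.+1 0 ps) (next_gaps d N.+1 ps) word_prob :> R.
Proof.
move=> ps Ips q0 sep; pose f := gap_pos d (first_gap N.+1 0 ps) (next_gaps d N.+1 ps).
have fE p : f p = (p \in ps) by rewrite /f (gap_pos_gaps _ q0 sep) addn0.
rewrite (@dcountE R d N _ f) //.
- by rewrite gap_sumE // (gap_size_gaps q0 sep).
- by move=> p; rewrite fE Ips.
- by move=> p; rewrite fE => /mapP[j _ ->].
Qed.

End Counting.

Section SqrtSpacing.
Context {R : realType} (d : nat).
Local Notation th := (@decay R).

(** A distance s between starting points leaves s - (d + 1) letters between the
    runs. *)
Lemma sqrt_spaced_gaps a n s (i : 'I_a -> 'I_n) : (d < s)%N ->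
  s%:R <= Num.sqrt (n%:R : R) -> (s <= n)%N -> sqrt_spaced R i ->
  gaps_at_least d n (s - d.+1) 0 [seq nat_of_ord (i j) | j <- enum 'I_a].
Proof.
move=> ds sn sn' [h0 hS hlast]; set ps := map _ _.
have sz : size ps = a by rewrite size_map size_enum_ord.
have nthE j (ja : (j < a)%N) : nth 0%N ps j = i (Ordinal ja).
  rewrite (nth_map (Ordinal ja)) ?size_enum_ord //; congr (nat_of_ord (i _)).
  by apply: val_inj; rewrite /= nth_enum_ord.
apply: gaps_at_least_nth; rewrite sz.
  move=> [|j] ja; rewrite (nthE _ ja).
    have := le_trans sn (h0 (Ordinal ja) erefl); rewrite /pos ler_nat; lia.
  have ja' := ltnW ja; rewrite (nthE _ ja').
  have := le_trans sn (hS (Ordinal ja') (Ordinal ja) erefl).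
  by rewrite /pos lerBrDr -natrD ler_nat; lia.
case: a i h0 hS hlast ps sz nthE => [|a] i h0 hS hlast ps sz nthE; first by lia.
rewrite (nthE a (ltnSn a)).
have := le_trans sn (hlast (Ordinal (ltnSn a)) erefl).
by rewrite /pos lerBrDr -natrD ler_nat; lia.
Qed.

(** Bernoulli's inequality for (6/5)^q. *)
Lemma bernoulli_decay q : th ^+ q * q.+1%:R <= 5.
Proof.
have B : 1 + q%:R / 5 <= (6 / 5 : R) ^+ q.
  elim: q => [|q IH]; first by rewrite mul0r addr0 expr0.
  rewrite exprS -(natr1 q); have : (0 : R) <= q%:R by [].
  by move: IH; set z := _ ^+ q; lra.
have t0 := decay_pow_ge0 (R := R) q.
have := ler_wpM2l t0 B; rewrite decay_inv -(natr1 q).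
have : 0 <= th ^+ q * q%:R by rewrite mulr_ge0.
by move: t0; set z := th ^+ q; set w := q%:R; lra.
Qed.

(** From decay ^+ q = O(1 / q) with q of order sqrt n, and
    n^(-1/2) <= n^(-1/6). *)
Lemma decay_le_powR n s : (0 < n)%N -> (d < s)%N ->
  Num.sqrt (n%:R : R) <= s.+1%:R ->
  th ^+ (s - d.+1) <= 5 * (d.+2)%:R * (n%:R : R) `^ (- (1 / 6%:R)).
Proof.
move=> n0 ds hs.
have n1 : 1 <= n%:R :> R by rewrite ler1n.
have r0 : 0 < Num.sqrt (n%:R : R) by rewrite sqrtr_gt0 ltr0n.
have p0 : 0 < (n%:R : R) `^ (1 / 6%:R) by apply: powR_gt0; rewrite ltr0n.
have hp : (n%:R : R) `^ (1 / 6%:R) <= Num.sqrt n%:R.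
  by rewrite -powR12_sqrt //; apply: ler_powR => //; lra.
rewrite powRN ler_pdivlMr //.
have t0 := decay_pow_ge0 (R := R) (s - d.+1).
apply: le_trans (ler_wpM2l t0 (le_trans hp hs)) _.
have : (s.+1 <= (s - d.+1).+1 * d.+2)%N by nia.
rewrite -(ler_nat R) natrM => h.
apply: le_trans (ler_wpM2l t0 h) _.
by rewrite mulrA ler_wpM2r // bernoulli_decay.
Qed.

End SqrtSpacing.

Theorem theorem7p4 (R : realType) (k a : nat) (hk : (3 <= k)%N) (ha : (0 < a)%N) :
  exists C : R, 0 < C /\
  exists (K : R) (N : nat),
    forall n : nat, (0 < n)%N -> (N <= n)%N ->
    forall i : 'I_a -> 'I_n, sqrt_spaced R i ->
    exists e : R,
      `|e| <= K * ((n%:R : R) `^ (- (1 / 6%:R))) /\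
      (dcount k [set i j | j : 'I_a]%SET)%:R = C * (fcount k n)%:R * (1 + e).
Proof.
case: k hk => [//|d]; rewrite ltnS => d_gt1; have d_gt0 := ltnW d_gt1.
have [x hx root_le] := @root_exists R d d_gt1.
set c := limit_prob d x; have c0 : 0 < c := limit_prob_gt0 d_gt1 hx root_le.
set S := junction_const d x; have S0 : 0 < S := junction_const_gt0 d_gt1 hx.
have x0 : 0 < x by move: hx => /andP[]; lra.
pose T := (c * S * x ^+ d.+1) ^+ a.
have T0 : 0 < T by rewrite exprn_gt0 // !mulr_gt0 // exprn_gt0.
exists T; split=> //.
have [C C0 HC] := gap_sum_asymptotics d_gt1 hx root_le a (ltW c0) (lexx 0)
  (ler0n R 5).
have c20 : 0 < c / 2 by lra.
have [N1 HN1] := @geometric_small R 5 decay (c / 2) (@decay_itv R) c20.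
(* N1 ensures that scaled_prob exceeds c / 2; the square, that the gaps are
   not empty. *)
exists ((C + 5 * T) / (T * (c / 2)) * (5 * (d.+2)%:R)), (maxn N1 ((d + 3) ^ 2)).
move=> [//|N] _; rewrite geq_max => /andP[nN1 nd] i sp.
set n := N.+1.
have /andP[sr rs] := truncn_itv (sqrtr_ge0 (n%:R : R)).
set s := Num.trunc _ in sr rs.
have ds : (d.+2 < s.+1)%N.
  rewrite -(ltr_nat R); apply: le_lt_trans rs.
  rewrite -[leLHS]ger0_norm // -sqrtr_sqr ler_sqrt // -natrX ler_nat.
  apply: leq_trans nd; rewrite leq_exp2r //; lia.
have sn : (s <= n)%N.
  rewrite -(ler_nat R); apply: le_trans sr _.
  rewrite -[leRHS]ger0_norm // -sqrtr_sqr ler_sqrt ?sqr_ge0 //.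
  by rewrite -natrX ler_nat; nia.
have ds' : (d < s)%N := ltnW (ds : (d.+1 < s)%N).
have sep := sqrt_spaced_gaps ds' sr sn sp.
pose q := (s - d.+1)%N; rewrite -/q in sep.
have q0 : (0 < q)%N by rewrite subn_gt0.
have qn : (q <= n)%N := leq_trans (leq_subr _ _) sn.
have hq := decay_le_powR (ltn0Sn N) ds' (ltW rs); rewrite -/q in hq.
set ps := map _ _ in sep.
pose G : R := gap_sum d (first_gap N.+1 0 ps) (next_gaps d N.+1 ps) word_prob.
have dE : (dcount d.+1 [set i j | j : 'I_a]%SET)%:R = N.+1`!%:R * G :> R.
  apply: (dcount_gap_sum d_gt1 _ q0 sep) => p.
  apply/imsetP/mapP => [[j _ ->]|[j _ pj]].
    by exists j => //; rewrite mem_enum.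
  by exists j => //; apply: val_inj.
rewrite dE fcountE //.
have ok0 : context_ok d x word_prob c (0 * decay ^+ q) 5.
  by rewrite mul0r; exact: word_prob_context_ok.
have := HC q _ _ _ _ _ ok0 => /(_ (first_gap N.+1 0 ps) (next_gaps d N.+1 ps)).
rewrite size_next_gaps size_map size_enum_ord => /(_ erefl).
have hall : all (fun b' => (q <= b'.+1)%N) (first_gap N.+1 0 ps :: next_gaps d N.+1 ps).
  by apply: sub_all (gaps_large sep) => b'; case: (q).
move=> /(_ hall); rewrite (gap_size_gaps q0 sep) subn0 /= -/G -/T => hG.
have hy := scaled_prob_limit d_gt1 hx root_le N.+1.
have hy2 : c / 2 < scaled_prob d x N.+1.
  have := HN1 _ nN1; move: hy; rewrite ler_norml => /andP[h1 h2] h3.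
  move: h1; rewrite -/c; lra.
have hyq : `|scaled_prob d x N.+1 - c| <= 5 * decay ^+ q.
  by apply: le_trans hy _; rewrite ler_wpM2l // decay_pow_mono.
set y := scaled_prob d x N.+1 in hy2 hyq *.
have y0 : 0 < y by apply: lt_trans hy2.
pose P := G * x ^+ N.+1.
(* P is close to c T and y is close to c, so P / (T y) is close to 1. *)
exists (P / (T * y) - 1); split.
  have -> : P / (T * y) - 1 = (P - c * T + T * (c - y)) / (T * y).
    by field; rewrite !gt_eqF.
  have D0 : 0 < T * (c / 2) by rewrite mulr_gt0.
  have tq := decay_pow_ge0 (R := R) q.
  apply: (@le_trans _ _ ((C + 5 * T) / (T * (c / 2)) * decay ^+ q)); last first.
    rewrite -[leRHS]mulrA ler_wpM2l // divr_ge0 ?(ltW D0) // addr_ge0 // mulr_ge0 //.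
    exact: ltW.
  rewrite normrM normfV (gtr0_norm (mulr_gt0 T0 y0)).
  rewrite [leRHS]mulrAC.
  apply: ler_pM => //; first by rewrite invr_ge0 ltW // mulr_gt0.
    apply: le_trans (ler_normD _ _) _; rewrite mulrDl; apply: lerD; first exact: hG.
    rewrite normrM (gtr0_norm T0) distrC [5 * T]mulrC -mulrA ler_wpM2l //.
    exact: ltW.
  have hTy : T * (c / 2) <= T * y by apply: ler_wpM2l; exact: ltW.
  by rewrite lef_pV2 // posrE // mulr_gt0.
rewrite addrC subrK.
have u0 : free_prob R d N.+1 != 0.
  by apply/eqP => u0; move: y0; rewrite /y /scaled_prob u0 mul0r ltxx.
have yE : y = free_prob R d N.+1 * x ^+ N.+1 by [].
have X0 : x ^+ N.+1 != 0 by rewrite expf_neq0 // gt_eqF.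
have Tn0 : T != 0 by rewrite gt_eqF.
rewrite yE /P -[free_sum d N word_prob]/(free_prob R d N.+1).
move: (N.+1`!%:R) (free_prob R d N.+1) (x ^+ N.+1) u0 X0 => f v z v0 z0.
by clearbody G T; field; rewrite v0 z0 Tn0.
Qed.
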